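(* Suppose the graph assumption, the function assumption, the Bregman–Lipschitz assumption and the contractivity assumption (all defined in the context) hold. Let $\kappa\in(0,1)$. For any $T\in\mathbb{N}_+$, let $\boldsymbol{x}_T=(x_1,\dots,x_T)$ be the sequence generated by the algorithm described in the context with all $\Phi_{i,t}$ being the identity mapping and $$\alpha_t=\frac{1}{t^{\kappa}},\quad \beta_t=\frac{1}{t^{\kappa}},\quad \gamma_t=\frac{1}{t^{1-\kappa}},\quad \forall t\in\mathbb{N}_+ .$$ Then $$\mathrm{Reg}(\boldsymbol{x}_T,\check{\boldsymbol{x}}^*_T)\le C_1T^{\max\{1-\kappa,\kappa\}},\qquad \Big\|\Big[\sum_{t=1}^Tg_{t}(x_{t})\Big]_+\Big\|\le \sqrt{C_{2}}\,T^{1-\kappa/2},$$ where $C_1=\frac{C_{1,1}}{\kappa}+\frac{C_{1,2}}{1-\kappa}+2n\,d(X)K$, $C_{2,1}=2n\big(\frac{2G^2}{(1-\kappa)\underline{\sigma}}+\frac{1}{1-\kappa}+2\big)$ and $C_{2}=C_{2,1}(2nF+C_1)$.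
   Context: Problem. There are $n$ agents, $[n]=\{1,\dots,n\}$. For each $i\in[n]$, $X_i\subseteq\mathbb{R}^{p_i}$ is closed and convex; $X=X_1\times\cdots\times X_n$, and points of $X$ are written $x_t=\mathrm{col}(x_{1,t},\dots,x_{n,t})$. For $t\in\mathbb{N}_+$, $f_{i,t},r_{i,t}:X_i\to\mathbb{R}$ and $g_{i,t}:X_i\to\mathbb{R}^m$ are convex (componentwise for $g_{i,t}$). Put $f_t(x)=\sum_{i=1}^n(f_{i,t}(x_i)+r_{i,t}(x_i))$ and $g_t(x)=\sum_{i=1}^n g_{i,t}(x_i)$. Vector inequalities are componentwise, $[\cdot]_+$ is the componentwise projection onto the nonnegative orthant, $\|\cdot\|$ is the Euclidean norm (induced 2-norm for matrices). Let $\mathcal{X}_T=\{(x_1,\dots,x_T): x_t\in X,\ g_t(x_t)\le \mathbf{0}_m,\ t=1,\dots,T\}$ and $\check{\mathcal{X}}_T=\{(x,\dots,x): x\in X,\ g_t(x)\le\mathbf{0}_m,\ t=1,\dots,T\}\subseteq\mathcal{X}_T$, assumed nonempty for every $T\in\mathbb{N}_+$. The regret of $\boldsymbol{x}_T=(x_1,\dots,x_T)$ with respect to $\boldsymbol{y}_T=(y_1,\dots,y_T)\in\mathcal{X}_T$ is $\mathrm{Reg}(\boldsymbol{x}_T,\boldsymbol{y}_T)=\sum_{t=1}^Tf_t(x_t)-\sum_{t=1}^Tf_t(y_t)$. $\check{\boldsymbol{x}}^*_T\in\arg\min_{\boldsymbol{x}_T\in\check{\mathcal{X}}_T}\sum_{t=1}^Tf_t(x_t)$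 is the static optimal sequence. Subgradients. $\nabla f(x)$ denotes a (fixed choice of) subgradient of a convex function $f$ on its domain at $x$ (the gradient if differentiable), i.e. $f(y)\ge f(x)+\langle\nabla f(x),y-x\rangle$ for all $y$ in the domain; for a vector function, $\nabla g(x)\in\mathbb{R}^{m\times p}$ has as rows the transposed subgradients of the components. Bregman divergence. For each $i$, $\psi_i:X_i\to\mathbb{R}$ is differentiable and strongly convex with parameter $\sigma_i>0$, i.e. $\psi_i(x)\ge\psi_i(y)+\langle\nabla\psi_i(y),x-y\rangle+\frac{\sigma_i}{2}\|x-y\|^2$; $\mathcal{D}_{\psi_i}(x,y)=\psi_i(x)-\psi_i(y)-\langle\nabla\psi_i(y),x-y\rangle$; $\underline{\sigma}=\min_i\sigma_i$. Algorithm. Given positive non-increasing sequences $\{\alpha_t\},\{\beta_t\},\{\gamma_t\}$, maps $\Phi_{i,t}:X_i\to X_i$, and matrices $W_t\in\mathbb{R}^{n\times n}$. Initialize with arbitrary $x_{i,0}\in X_i$, $f_{i,0}=r_{i,0}\equiv0$, $g_{i,0}\equiv\mathbf{0}_m$, $q_{i,0}=\mathbf{0}_m$. For $t=1,2,\dots$ and each $i\in[n]$: $\tilde q_{i,t}=\sum_{j=1}^n[W_{t-1}]_{ij}q_{j,t-1}$; $a_{i,t}=\nabla f_{i,t-1}(x_{i,t-1})+(\nabla g_{i,t-1}(x_{i,t-1}))^\top\tilde q_{i,t}$; $\tilde x_{i,t}=\arg\min_{x\in X_i}\{\alpha_t\langle x,a_{i,t}\rangle+\alpha_tr_{i,t-1}(x)+\mathcal{D}_{\psi_i}(x,x_{i,t-1})\}$;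 $b_{i,t}=\nabla g_{i,t-1}(x_{i,t-1})(\tilde x_{i,t}-x_{i,t-1})+g_{i,t-1}(x_{i,t-1})$; $q_{i,t}=[\tilde q_{i,t}+\gamma_t(b_{i,t}-\beta_t\tilde q_{i,t})]_+$; $x_{i,t}=\Phi_{i,t}(\tilde x_{i,t})$. Graph assumption. At time $t$ the agents communicate over a directed graph $\mathcal{G}_t=([n],\mathcal{E}_t)$; $[W_t]_{ij}>0$ if $(j,i)\in\mathcal{E}_t$ or $i=j$, and $[W_t]_{ij}=0$ otherwise. For every $t\in\mathbb{N}_+$: (1) there is a constant $w\in(0,1)$ with $[W_t]_{ij}\ge w$ whenever $[W_t]_{ij}>0$; (2) $W_t$ is doubly stochastic; (3) there is an integer $\iota>0$ such that the graph $([n],\cup_{l=0}^{\iota-1}\mathcal{E}_{t+l})$ is strongly connected. ($w$ and $\iota$ do not depend on $t$.) Function assumption. (1) Each $X_i$ is convex and compact; (2) $f_{i,t},r_{i,t},g_{i,t}$ are convex and there is $F>0$ with $\|f_{i,t}(x)\|,\|r_{i,t}(x)\|,\|g_{i,t}(x)\|\le F$ for all $t\in\mathbb{N}_+,i\in[n],x\in X_i$; (3) the subgradients exist and there is $G>0$ with $\|\nabla f_{i,t}(x)\|,\|\nabla r_{i,t}(x)\|,\|\nabla g_{i,t}(x)\|\le G$ for all such $t,i,x$. Bregman–Lipschitz assumption. There is $K>0$ with $|\mathcal{D}_{\psi_i}(x_1,y)-\mathcal{D}_{\psi_i}(x_2,y)|\le K\|x_1-x_2\|$ for all $i\in[n]$,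 $x_1,x_2,y\in X_i$. Contractivity assumption. $\mathcal{D}_{\psi_i}(\Phi_{i,t}(x),\Phi_{i,t}(y))\le\mathcal{D}_{\psi_i}(x,y)$ for all $t\in\mathbb{N}_+$, $i\in[n]$, $x,y\in X_i$ (trivially true for identity mappings). Further notation. $d(X)>0$ is a constant with $\|x-y\|\le d(X)$ for all $x,y\in X$. Constants: $\tau=(1-\frac{w}{2n^2})^{-2}$, $\lambda=(1-\frac{w}{2n^2})^{1/\iota}$, $B_1=2F+Gd(X)$, $C_{1,1}=\frac{3n^2\tau B_1F}{1-\lambda}+\frac{n(B_1)^2}{2}$, $C_{1,2}=\frac{4nG^2}{\underline{\sigma}}$. *)

(* Defs.v *)
From HB Require Import structures.
From mathcomp Require Import all_boot all_order all_algebra.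
From mathcomp Require Import all_classical all_reals all_analysis.

Set Implicit Arguments.
Unset Strict Implicit.
Unset Printing Implicit Defensive.
Import Order.TTheory GRing.Theory Num.Theory.
Import numFieldNormedType.Exports.
Local Open Scope classical_set_scope.
Local Open Scope ring_scope.

(* The library norm on matrices is the sup norm, so the Euclidean norm and
   the induced 2-norm are defined here. *)
Section Euclidean.
Variable R : realType.

Definition dot k (u v : 'cV[R]_k) : R := \sum_(j < k) u j 0 * v j 0.

Definition enorm k (v : 'cV[R]_k) : R := Num.sqrt (\sum_(j < k) v j 0 ^+ 2).

Definition opnorm k l (A : 'M[R]_(k, l)) : R :=
  sup [set enorm (A *m v) | v in [set v : 'cV[R]_l | enorm v <= 1]].

Definition pospart k (v : 'cV[R]_k) : 'cV[R]_k := \col_j Num.max (v j 0) 0.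

Definition cvle k (u v : 'cV[R]_k) : Prop := forall j, u j 0 <= v j 0.

Definition argmin_on T (A : set T) (h : T -> R) : set T :=
  [set z | A z /\ forall y, A y -> h z <= h y].

Definition subgradient k (A : set 'cV[R]_k) (h : 'cV[R]_k -> R)
    (x v : 'cV[R]_k) : Prop :=
  forall y, A y -> h x + dot v (y - x) <= h y.

(* Differentiability at x of a function whose domain is A only: the
   first-order expansion is required for increments that stay in A, so that
   boundary points of A are covered. *)
Definition gradient_within k (A : set 'cV[R]_k) (h : 'cV[R]_k -> R)
    (x v : 'cV[R]_k) : Prop :=
  forall e : R, 0 < e ->
    \forall y \near within A (nbhs x),
      `|h y - h x - dot v (y - x)| <= e * enorm (y - x).

End Euclidean.

(* Functions with domain X_i are total functions on R^(p i) that are only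
   constrained and used on X_i; df, dr, dg are the chosen subgradients, the
   rows of dg i t x being the subgradients of the components of g i t.
   Rounds start at t = 1; the round-0 values are those set by the algorithm
   (see algorithm_run). *)
Record problem (R : realType) (n m : nat) (p : 'I_n -> nat) := Problem {
  X_ : forall i, set 'cV[R]_(p i);
  f_ : forall i, nat -> 'cV[R]_(p i) -> R;
  r_ : forall i, nat -> 'cV[R]_(p i) -> R;
  g_ : forall i, nat -> 'cV[R]_(p i) -> 'cV[R]_m;
  df_ : forall i, nat -> 'cV[R]_(p i) -> 'cV[R]_(p i);
  dr_ : forall i, nat -> 'cV[R]_(p i) -> 'cV[R]_(p i);
  dg_ : forall i, nat -> 'cV[R]_(p i) -> 'M[R]_(m, p i) }.

Record mirror (R : realType) (n : nat) (p : 'I_n -> nat) := Mirror {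
  psi_ : forall i, 'cV[R]_(p i) -> R;
  dpsi_ : forall i, 'cV[R]_(p i) -> 'cV[R]_(p i);
  sigma_ : 'I_n -> R }.

Record trajectory (R : realType) (n m : nat) (p : 'I_n -> nat) := Trajectory {
  x_ : forall i, nat -> 'cV[R]_(p i);
  xt_ : forall i, nat -> 'cV[R]_(p i);
  q_ : 'I_n -> nat -> 'cV[R]_m;
  qt_ : 'I_n -> nat -> 'cV[R]_m }.

Arguments X_ {R n m p} _ i.
Arguments f_ {R n m p} _ i t z.
Arguments r_ {R n m p} _ i t z.
Arguments g_ {R n m p} _ i t z.
Arguments df_ {R n m p} _ i t z.
Arguments dr_ {R n m p} _ i t z.
Arguments dg_ {R n m p} _ i t z.
Arguments psi_ {R n p} _ i z.
Arguments dpsi_ {R n p} _ i z.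

Section Model.
Variables (R : realType) (n m : nat) (p : 'I_n -> nat).
Variables (P : problem R m p) (M : mirror R p).

Definition point := forall i, 'cV[R]_(p i).

Definition prodX : set point := [set z | forall i, X_ P i (z i)].

Definition ftot (t : nat) (z : point) : R :=
  \sum_(i < n) (f_ P i t (z i) + r_ P i t (z i)).

Definition gtot (t : nat) (z : point) : 'cV[R]_m := \sum_(i < n) g_ P i t (z i).

(* A sequence (x_1, ..., x_T) is a function on nat of which only the values
   at 1, ..., T matter. *)
Definition static_point (T : nat) : set point :=
  [set z | prodX z /\ forall t, (1 <= t <= T)%N -> cvle (gtot t z) 0].

Definition static_seq (T : nat) : set (nat -> point) :=
  [set ys | exists2 z, static_point T z &
              forall t, (1 <= t <= T)%N -> ys t = z].

Definition total_loss (T : nat) (ys : nat -> point) : R :=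
  \sum_(1 <= t < T.+1) ftot t (ys t).

Definition regret (T : nat) (xs ys : nat -> point) : R :=
  total_loss T xs - total_loss T ys.

Definition static_optimal (T : nat) : set (nat -> point) :=
  argmin_on (static_seq T) (total_loss T).

Definition breg i (y z : 'cV[R]_(p i)) : R :=
  psi_ M i y - psi_ M i z - dot (dpsi_ M i z) (y - z).

Definition strongly_convex i : Prop :=
  0 < sigma_ M i /\
  forall y z, X_ P i y -> X_ P i z ->
    psi_ M i z + dot (dpsi_ M i z) (y - z) + sigma_ M i / 2 * enorm (y - z) ^+ 2
      <= psi_ M i y.

Record standing : Prop := {
  X_closed : forall i, closed (X_ P i);
  X_convex : forall i, @convex_set R 'cV[R]_(p i) (X_ P i);
  static_nonempty : forall T, (0 < T)%N -> static_seq T !=set0;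
  psi_diff : forall i z, X_ P i z ->
    gradient_within (X_ P i) (psi_ M i) z (dpsi_ M i z);
  psi_strong : forall i, strongly_convex i }.

Definition sigma_min (n_gt0 : (0 < n)%N) : R :=
  \big[Num.min/sigma_ M (Ordinal n_gt0)]_(i < n) sigma_ M i.

Definition diameter_bound (d : R) : Prop :=
  0 < d /\
  forall y z, prodX y -> prodX z ->
    enorm (\mxcol_(i < n) y i - \mxcol_(i < n) z i) <= d.

Record function_assumption (F G : R) : Prop := {
  X_compact : forall i,
    @convex_set R 'cV[R]_(p i) (X_ P i) /\ compact (X_ P i);
  f_convex : forall i t, (0 < t)%N ->
    @convex_function R 'cV[R]_(p i) (X_ P i) (f_ P i t);
  r_convex : forall i t, (0 < t)%N ->
    @convex_function R 'cV[R]_(p i) (X_ P i) (r_ P i t);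
  g_convex : forall i t k, (0 < t)%N ->
    @convex_function R 'cV[R]_(p i) (X_ P i)
      (fun z : 'cV[R]_(p i) => g_ P i t z k 0);
  F_gt0 : 0 < F;
  F_bound : forall i t z, (0 < t)%N -> X_ P i z ->
    [/\ `|f_ P i t z| <= F, `|r_ P i t z| <= F & enorm (g_ P i t z) <= F];
  df_subgrad : forall i t z, (0 < t)%N -> X_ P i z ->
    subgradient (X_ P i) (f_ P i t) z (df_ P i t z);
  dr_subgrad : forall i t z, (0 < t)%N -> X_ P i z ->
    subgradient (X_ P i) (r_ P i t) z (dr_ P i t z);
  dg_subgrad : forall i t k z, (0 < t)%N -> X_ P i z ->
    subgradient (X_ P i) (fun y => g_ P i t y k 0) z (row k (dg_ P i t z))^T;
  G_gt0 : 0 < G;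
  G_bound : forall i t z, (0 < t)%N -> X_ P i z ->
    [/\ enorm (df_ P i t z) <= G, enorm (dr_ P i t z) <= G
      & opnorm (dg_ P i t z) <= G] }.

Definition bregman_lipschitz (K : R) : Prop :=
  0 < K /\
  forall i y1 y2 z, X_ P i y1 -> X_ P i y2 -> X_ P i z ->
    `|breg y1 z - breg y2 z| <= K * enorm (y1 - y2).

Definition contractive (Phi : forall i, nat -> 'cV[R]_(p i) -> 'cV[R]_(p i))
    : Prop :=
  forall i t y z, (0 < t)%N -> X_ P i y -> X_ P i z ->
    breg (Phi i t y) (Phi i t z) <= breg y z.

(* The argmin is a relation; strong convexity makes xt i t.+1 unique. *)
Record algorithm_run (W : nat -> 'M[R]_n)
    (Phi : forall i, nat -> 'cV[R]_(p i) -> 'cV[R]_(p i))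
    (alpha beta gamma : nat -> R) (Y : trajectory R m p) : Prop := {
  x_init : forall i, X_ P i (x_ Y i 0);
  f_init : forall i z, X_ P i z -> f_ P i 0 z = 0 /\ df_ P i 0 z = 0;
  r_init : forall i z, X_ P i z -> r_ P i 0 z = 0;
  g_init : forall i z, X_ P i z -> g_ P i 0 z = 0 /\ dg_ P i 0 z = 0;
  q_init : forall i, q_ Y i 0 = 0;
  qt_step : forall i t, qt_ Y i t.+1 = \sum_(j < n) W t i j *: q_ Y j t;
  xt_step : forall i t,
    let a := df_ P i t (x_ Y i t) + (dg_ P i t (x_ Y i t))^T *m qt_ Y i t.+1 in
    argmin_on (X_ P i)
      (fun z => alpha t.+1 * dot z a + alpha t.+1 * r_ P i t z
                + breg z (x_ Y i t))
      (xt_ Y i t.+1);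
  q_step : forall i t,
    let b := dg_ P i t (x_ Y i t) *m (xt_ Y i t.+1 - x_ Y i t)
             + g_ P i t (x_ Y i t) in
    q_ Y i t.+1 = pospart (qt_ Y i t.+1
                          + gamma t.+1 *: (b - beta t.+1 *: qt_ Y i t.+1));
  x_step : forall i t, x_ Y i t.+1 = Phi i t.+1 (xt_ Y i t.+1) }.

Definition iterates (Y : trajectory R m p) (t : nat) : point :=
  fun i => x_ Y i t.

End Model.

Definition doubly_stochastic (R : realType) n (A : 'M[R]_n) : Prop :=
  [/\ forall i j, 0 <= A i j,
      forall i, \sum_(j < n) A i j = 1
    & forall j, \sum_(i < n) A i j = 1].

(* E t j i holds when (j, i) is an edge of the graph at time t. *)
Record graph_assumption (R : realType) n (E : nat -> rel 'I_n)
    (W : nat -> 'M[R]_n) (w : R) (iota : nat) : Prop := {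
  W_pos : forall t i j, (0 < t)%N -> E t j i || (i == j) -> 0 < W t i j;
  W_zero : forall t i j, (0 < t)%N -> ~~ (E t j i || (i == j)) -> W t i j = 0;
  w_range : 0 < w < 1;
  W_ge : forall t i j, (0 < t)%N -> 0 < W t i j -> w <= W t i j;
  W_stoch : forall t, (0 < t)%N -> doubly_stochastic (W t);
  iota_gt0 : (0 < iota)%N;
  E_connected : forall t i j, (0 < t)%N ->
    connect (fun u v => [exists l : 'I_iota, E (t + l)%N u v]) i j }.

Section Constants.
Variables (R : realType) (n iota : nat) (w F G d K s kappa : R).

Definition tau : R := (1 - w / (2 * n%:R ^+ 2)) ^- 2.

Definition lambda : R := (1 - w / (2 * n%:R ^+ 2)) `^ (1 / iota%:R).

Definition B1 : R := 2 * F + G * d.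

Definition C11 : R :=
  3 * n%:R ^+ 2 * tau * B1 * F / (1 - lambda) + n%:R * B1 ^+ 2 / 2.

Definition C12 : R := 4 * n%:R * G ^+ 2 / s.

Definition C1 : R := C11 / kappa + C12 / (1 - kappa) + 2 * n%:R * d * K.

Definition C21 : R :=
  2 * n%:R * (2 * G ^+ 2 / ((1 - kappa) * s) + 1 / (1 - kappa) + 2).

Definition C2 : R := C21 * (2 * n%:R * F + C1).

End Constants.

(* Main.v *)
(* The Bregman three-point inequality for the primal step and the
   nonexpansiveness of the projection in the dual step combine, for every
   [v >= 0] and every feasible static [y], into one upper bound for the sum of
   [<v, b_t>] minus the linearised gain of [y] plus the movement cost
   (master_bound).  The coupling term [sum_i <qt_i, g_i(y_i)>] is at most its
   part orthogonal to the consensus direction, which the mixing matrices damp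
   geometrically.  Taking [v = 0] gives the regret bound.  For the violation,
   [v] is a multiple of the positive part of [sum_t g_t(x_t)]; the gain of [y]
   is then bounded by [2 G |y - x|], which Young's inequality and the
   Bregman-Lipschitz constant absorb into [C_1], so that no lower bound on the
   regret is needed.

   The damping over [iota] rounds follows from the largest gap between sorted
   values alone: it yields a variance contraction [1 - w / (2 n^3)], which is
   weaker than the rate behind [lambda] but is compensated by the factor [3 n^2]
   in [C_11]. *)
Require Import Defs.
From HB Require Import structures.
From mathcomp Require Import all_boot all_order all_algebra.
From mathcomp Require Import all_classical all_reals all_analysis.
From mathcomp Require Import ring lra zify.
Import Order.TTheory GRing.Theory Num.Theory.
Import numFieldNormedType.Exports.
Local Open Scope classical_set_scope.
Local Open Scope ring_scope.

(** * Euclidean norm *)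

(** Lagrange's identity: twice the gap between the two sides is the sum of the squared minors
    [u i * v j - u j * v i]. *)
Lemma cauchy_schwarz_sum (R : realType) (I : finType) (u v : I -> R) :
  (\sum_i u i * v i) ^+ 2 <= (\sum_i u i ^+ 2) * (\sum_i v i ^+ 2).
Proof.
rewrite -subr_ge0 -(pmulr_lge0 _ (ltr0n R 2)).
have -> : ((\sum_i u i ^+ 2) * (\sum_i v i ^+ 2) - (\sum_i u i * v i) ^+ 2) * 2
   = \sum_i \sum_j (u i * v j - u j * v i) ^+ 2.
  have E i j : (u i * v j - u j * v i) ^+ 2 =
      u i ^+ 2 * v j ^+ 2 + v i ^+ 2 * u j ^+ 2 - 2 * (u i * v i) * (u j * v j).
    by ring.
  under [RHS]eq_bigr => i _ do under eq_bigr => j _ do rewrite E.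
  under [RHS]eq_bigr => i _ do
    rewrite sumrB big_split /= -!mulr_sumr.
  rewrite sumrB big_split /= -!mulr_suml -mulr_sumr; ring.
by apply: sumr_ge0 => i _; apply: sumr_ge0 => j _; exact: sqr_ge0.
Qed.

Section EuclideanTheory.
Local Set Implicit Arguments.
Local Unset Strict Implicit.
Variable R : realType.
Implicit Types k : nat.

Lemma enorm_ge0 k (v : 'cV[R]_k) : 0 <= enorm v.
Proof. exact: sqrtr_ge0. Qed.

Lemma sqr_enorm k (v : 'cV[R]_k) : enorm v ^+ 2 = \sum_j v j 0 ^+ 2.
Proof. by rewrite sqr_sqrtr // sumr_ge0 // => j _; exact: sqr_ge0. Qed.

Lemma enorm_le k (v : 'cV[R]_k) (c : R) :
  0 <= c -> \sum_j v j 0 ^+ 2 <= c ^+ 2 -> enorm v <= c.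
Proof.
by move=> c0 h; rewrite -(@ler_pXn2r _ 2) ?nnegrE ?enorm_ge0// sqr_enorm.
Qed.

Lemma enorm_mono k l (u : 'cV[R]_k) (v : 'cV[R]_l) :
  \sum_j u j 0 ^+ 2 <= \sum_j v j 0 ^+ 2 -> enorm u <= enorm v.
Proof. by move=> h; apply: enorm_le; rewrite ?enorm_ge0 ?sqr_enorm. Qed.

Lemma dotC k (u v : 'cV[R]_k) : dot u v = dot v u.
Proof. by apply: eq_bigr => j _; rewrite mulrC. Qed.

Lemma dotDr k (u v z : 'cV[R]_k) : dot z (u + v) = dot z u + dot z v.
Proof. by rewrite /dot -big_split; apply: eq_bigr => j _; rewrite mxE mulrDr. Qed.

Lemma dotNr k (u v : 'cV[R]_k) : dot u (- v) = - dot u v.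
Proof. by rewrite /dot -sumrN; apply: eq_bigr => j _; rewrite mxE mulrN. Qed.

Lemma dotBr k (u v z : 'cV[R]_k) : dot z (u - v) = dot z u - dot z v.
Proof. by rewrite dotDr dotNr. Qed.

Lemma dotZr k (a : R) (u v : 'cV[R]_k) : dot u (a *: v) = a * dot u v.
Proof. by rewrite /dot mulr_sumr; apply: eq_bigr => j _; rewrite mxE mulrCA. Qed.

Lemma dotDl k (u v z : 'cV[R]_k) : dot (u + v) z = dot u z + dot v z.
Proof. by rewrite dotC dotDr !(dotC z). Qed.

Lemma dotNl k (u v : 'cV[R]_k) : dot (- u) v = - dot u v.
Proof. by rewrite dotC dotNr dotC. Qed.

Lemma dotBl k (u v z : 'cV[R]_k) : dot (u - v) z = dot u z - dot v z.
Proof. by rewrite dotDl dotNl. Qed.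

Lemma dotZl k (a : R) (u v : 'cV[R]_k) : dot (a *: u) v = a * dot u v.
Proof. by rewrite dotC dotZr dotC. Qed.

Lemma dot_sumr k (I : Type) (r : seq I) (Q : pred I) (u : I -> 'cV[R]_k) v :
  dot v (\sum_(i <- r | Q i) u i) = \sum_(i <- r | Q i) dot v (u i).
Proof.
apply: (big_morph (fun z => dot v z)); first by move=> x y; rewrite dotDr.
by rewrite /dot big1 // => j _; rewrite mxE mulr0.
Qed.

Lemma dot_self k (v : 'cV[R]_k) : dot v v = enorm v ^+ 2.
Proof. by rewrite sqr_enorm; apply: eq_bigr => j _; rewrite expr2. Qed.

Lemma sqr_enormB k (u v : 'cV[R]_k) :
  enorm (u - v) ^+ 2 = enorm u ^+ 2 - 2 * dot u v + enorm v ^+ 2.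
Proof. by rewrite -!dot_self dotBl !dotBr (dotC v u); ring. Qed.

Lemma sqr_enormD k (u v : 'cV[R]_k) :
  enorm (u + v) ^+ 2 = enorm u ^+ 2 + 2 * dot u v + enorm v ^+ 2.
Proof. by rewrite -!dot_self dotDl !dotDr (dotC v u); ring. Qed.

Lemma dot_mulmx k l (A : 'M[R]_(k, l)) u v : dot u (A *m v) = dot (A^T *m u) v.
Proof.
rewrite /dot; under eq_bigr => i _ do rewrite mxE mulr_sumr.
rewrite exchange_big /=; apply: eq_bigr => j _.
rewrite mxE mulr_suml; apply: eq_bigr => i _; rewrite mxE; ring.
Qed.

Lemma dot_le_enorm k (u v : 'cV[R]_k) : dot u v <= enorm u * enorm v.
Proof.
apply: (le_trans (ler_norm _)).
rewrite -(@ler_pXn2r _ 2) ?nnegrE ?mulr_ge0 ?enorm_ge0// exprMn !sqr_enorm.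
by rewrite real_normK ?num_real // cauchy_schwarz_sum.
Qed.

Lemma enormN k (v : 'cV[R]_k) : enorm (- v) = enorm v.
Proof. by congr Num.sqrt; apply: eq_bigr => j _; rewrite mxE sqrrN. Qed.

Lemma enormZ k (a : R) (v : 'cV[R]_k) : enorm (a *: v) = `|a| * enorm v.
Proof.
rewrite -sqrtr_sqr -sqrtrM ?sqr_ge0// mulr_sumr; congr Num.sqrt.
by apply: eq_bigr => j _; rewrite mxE exprMn.
Qed.

Lemma enorm0 k : enorm (0 : 'cV[R]_k) = 0.
Proof. by rewrite -(scale0r 0) enormZ normr0 mul0r. Qed.

Lemma enormD k (u v : 'cV[R]_k) : enorm (u + v) <= enorm u + enorm v.
Proof.
rewrite -(@ler_pXn2r _ 2) ?nnegrE ?addr_ge0 ?enorm_ge0//.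
rewrite sqr_enormD.
have := dot_le_enorm u v; nra.
Qed.

Lemma enorm_eq0 k (v : 'cV[R]_k) : enorm v = 0 -> v = 0.
Proof.
move=> v0; apply/matrixP => i j; rewrite ord1 mxE; apply/eqP.
have := sqr_enorm v; rewrite v0 expr0n /= => /esym/eqP.
rewrite psumr_eq0 => [/allP /(_ i)|? _]; last exact: sqr_ge0.
by rewrite mem_index_enum sqrf_eq0 => /(_ isT).
Qed.

Lemma enorm_mulmx k l (A : 'M[R]_(k, l)) (v : 'cV[R]_l) :
  enorm (A *m v) <= opnorm A * enorm v.
Proof.
set S := [set enorm (A *m v) | v in [set v : 'cV[R]_l | enorm v <= 1]].
have [v0|v0] := eqVneq (enorm v) 0.
  by rewrite v0 mulr0 (enorm_eq0 v0) mulmx0 enorm0.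
have vp : 0 < enorm v by rewrite lt_neqAle eq_sym v0 enorm_ge0.
rewrite -ler_pdivrMr //.
have -> : enorm (A *m v) / enorm v = enorm (A *m ((enorm v)^-1 *: v)).
  by rewrite -scalemxAr enormZ ger0_norm ?invr_ge0 ?enorm_ge0// mulrC.
apply: ub_le_sup.
  (* The Frobenius norm of [A], through Cauchy-Schwarz on each row, bounds the set, so that its
     [sup] is a genuine upper bound. *)
  exists (Num.sqrt (\sum_i \sum_j A i j ^+ 2)) => _ [u /= u1 <-].
  apply: ler_wsqrtr; apply: ler_sum => i _; rewrite mxE.
  apply: (le_trans (cauchy_schwarz_sum _ _ _ _)).
  rewrite ler_piMr ?sumr_ge0 // => [j _|]; first exact: sqr_ge0.
  by rewrite -sqr_enorm expr_le1 ?enorm_ge0.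
exists ((enorm v)^-1 *: v) => //=.
by rewrite enormZ ger0_norm ?invr_ge0 ?enorm_ge0// mulVf.
Qed.

Lemma enorm_ge_coord k (v : 'cV[R]_k) j : `|v j 0| <= enorm v.
Proof.
rewrite -sqrtr_sqr; apply: ler_wsqrtr.
by rewrite (bigD1 j) //= lerDl sumr_ge0 // => i _; exact: sqr_ge0.
Qed.

Lemma pospart_ge0 k (v : 'cV[R]_k) j : 0 <= pospart v j 0.
Proof. by rewrite mxE le_max lexx orbT. Qed.

(** Passes the diameter bound from the product set to a single agent: reindexed by pairs of a block
    and a coordinate, the squared norm of the stacked column splits into those of its blocks. *)
Lemma enorm_mxcol n (p : 'I_n -> nat) (B : forall i, 'cV[R]_(p i)) i :
  enorm (B i) <= enorm (\mxcol_(i < n) B i).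
Proof.
apply: enorm_mono.
under [leRHS]eq_bigr => j _ do rewrite mxE.
have -> : \sum_j B (tagnat.sig1 j) (tagnat.sig2 j) 0 ^+ 2 =
    \sum_(u : {i : 'I_n & 'I_(p i)}) B (tag u) (tagged u) 0 ^+ 2.
  rewrite (reindex _ (tagnat.sig_bij_on (p_ := p))) /=.
  by apply: eq_bigr => j _; rewrite /tagnat.sig1 /tagnat.sig2.
rewrite -(sig_big_dep xpredT (fun _ => xpredT) (fun i j => B i j 0 ^+ 2)) /=.
rewrite [leRHS](bigD1 i) //= lerDl; apply: sumr_ge0 => i' _.
by apply: sumr_ge0 => j _; exact: sqr_ge0.
Qed.
End EuclideanTheory.

(** * Power sums *)

Section PowerSums.
Local Set Implicit Arguments.
Local Unset Strict Implicit.
Variable R : realType.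
Implicit Types (k : R) (t T : nat).

Lemma powR_nat_ge1 k t : (0 < t)%N -> 0 <= k -> 1 <= t%:R `^ k.
Proof. by move=> t0 k0; rewrite -[leLHS](powRr0 t%:R) ler_powR // ler1n. Qed.

Lemma powR_nat_le k s t : 0 <= k -> (s <= t)%N -> s%:R `^ k <= t%:R `^ k.
Proof. by move=> k0 st; rewrite ge0_ler_powR ?nnegrE ?ler0n// ler_nat. Qed.

Lemma powR_nat_compl k t : (0 < t)%N -> t%:R `^ k * t%:R `^ (1 - k) = t%:R.
Proof.
move=> t0; rewrite -powRD; last by rewrite pnatr_eq0 -lt0n t0 implybT.
by rewrite addrC subrK powRr1.
Qed.

(* Young's inequality for [(t / (t + 1)) `^ k * 1]. *)
Lemma powR_bernoulli k t : 0 < k < 1 ->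
  t%:R `^ k + k / t.+1%:R `^ (1 - k) <= t.+1%:R `^ k.
Proof.
move=> /andP[k0 k1].
have S0 : 0 < t.+1%:R :> R by rewrite ltr0n.
have P0 : 0 < t.+1%:R `^ k by rewrite powR_gt0.
have Q0 : 0 < t.+1%:R `^ (1 - k) by rewrite powR_gt0.
have PQ := powR_nat_compl k (ltn0Sn t).
have y0 : 0 <= t%:R / t.+1%:R :> R by rewrite divr_ge0.
have := @conjugate_powR R ((t%:R / t.+1%:R) `^ k) 1 k^-1 (1 - k)^-1
  (powR_ge0 _ _) ler01.
rewrite !invr_gt0 !invrK subr_gt0 k0 k1 => /(_ isT isT).
rewrite addrC subrK mulr1 powR1 mul1r -powRrM mulfV ?gt_eqF// powRr1//.
move=> /(_ erefl) Y.
have E : t%:R `^ k = (t%:R / t.+1%:R) `^ k * t.+1%:R `^ k.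
  by rewrite -powRM // divfK // gt_eqF.
have -> : k / t.+1%:R `^ (1 - k) = k / t.+1%:R * t.+1%:R `^ k.
  by rewrite -{2}PQ; field; rewrite !gt_eqF.
rewrite E -mulrDl -[leRHS]mul1r ler_wpM2r ?(ltW P0)//.
apply: (le_trans (lerD Y (lexx _))).
rewrite (_ : t%:R / t.+1%:R = 1 - t.+1%:R^-1 :> R); last first.
  by rewrite -natr1; field; rewrite natr1 gt_eqF.
rewrite le_eqVlt; apply/orP; left; apply/eqP; ring.
Qed.

(** Discrete form of the integral of [t ^ (-k)]: by [powR_bernoulli] with exponent [1 - k], the
    right side grows at each step by at least the new term. *)
Lemma sum_inv_powR k T : 0 < k < 1 ->
  \sum_(1 <= t < T.+1) 1 / t%:R `^ k <= T%:R `^ (1 - k) / (1 - k).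
Proof.
move=> /andP[k0 k1]; elim: T => [|T IH].
  by rewrite big_geq // divr_ge0 ?powR_ge0 // subr_ge0 ltW.
rewrite big_nat_recr //=; apply: (le_trans (lerD IH (lexx _))).
have k'1 : 0 < 1 - k < 1 by lra.
have := powR_bernoulli T k'1; rewrite subKr => B.
have k2 : 0 < 1 - k by lra.
rewrite ler_pdivlMr // mulrDl divfK ?gt_eqF//.
by apply: le_trans B; rewrite mulrAC mul1r.
Qed.

(** Multiplied by [(t + 1) ^ k], the left side becomes [t = t ^ k * t ^ (1 - k)]. This is how the
    decay [beta] pays for the growth of [1 / gamma] when the dual distances are telescoped. *)
Lemma powR_step k t : 0 < k < 1 -> (0 < t)%N ->
  t.+1%:R `^ (1 - k) - 1 / t.+1%:R `^ k <= t%:R `^ (1 - k).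
Proof.
move=> /andP[k0 k1] t0.
have P0 : 0 < t.+1%:R `^ k by rewrite powR_gt0.
have Q0 : 0 < t%:R `^ k by rewrite powR_gt0 // ltr0n.
have PQ := powR_nat_compl k (ltn0Sn t).
have PQ' := powR_nat_compl k t0.
rewrite -(ler_pM2l P0) mulrBr PQ mulrCA mulfV ?gt_eqF// mulr1.
rewrite -[in leLHS]natr1 addrK.
by rewrite -{1}PQ' ler_wpM2r ?powR_ge0 // powR_nat_le // ltW.
Qed.

Lemma powR_double k t : 0 < k < 1 -> (0 < t)%N ->
  t.+1%:R `^ k <= 2 * t%:R `^ k.
Proof.
move=> /andP[k0 k1] t0; apply: (@le_trans _ _ ((2 * t)%:R `^ k)).
  by apply: powR_nat_le; [exact: ltW | rewrite mul2n -addnn -addn1 leq_add2l].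
rewrite natrM powRM // ler_wpM2r ?powR_ge0 //.
by rewrite -{2}(@powRr1 _ 2) // ler_powR // ?ler1n // ltW.
Qed.

Lemma powR_nat_le_id k t : 0 < k < 1 -> (0 < t)%N -> t%:R `^ k <= t%:R.
Proof.
move=> /andP[k0 k1] t0; rewrite -{2}(@powRr1 _ t%:R) // ler_powR ?ler1n //.
exact: ltW.
Qed.

(** In [1 - l ^ N = (1 - l) * (1 + l + ... + l ^ (N - 1))] every power is at least [l ^ N]. It
    serves to compare [iota] with [1 / (1 - lambda)]. *)
Lemma root_gap (l : R) N : 0 <= l <= 1 ->
  N%:R * (1 - l) * l ^+ N <= 1 - l ^+ N.
Proof.
move=> /andP[l0 l1]; rewrite -[in leRHS](expr1n _ N) subrXX mulrAC mulrC.
rewrite ler_wpM2l ?subr_ge0 //.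
rewrite mulr_natl -[X in _ *+ X](card_ord N) -sumr_const; apply: ler_sum => i _.
by rewrite expr1n mul1r ler_wiXn2l // ltnW.
Qed.
End PowerSums.

(** * Variance contraction of mixing matrices *)

Section Consensus.
Local Set Implicit Arguments.
Local Unset Strict Implicit.
Variables (R : realType) (n : nat).
Implicit Types (x : 'I_n -> R) (A : 'M[R]_n).

Lemma row_variance A x i : \sum_j A i j = 1 ->
  \sum_j A i j * (x j - \sum_k A i k * x k) ^+ 2
    = \sum_j A i j * x j ^+ 2 - (\sum_j A i j * x j) ^+ 2.
Proof.
move=> A1; set y := \sum_k A i k * x k.
have E j : A i j * (x j - y) ^+ 2 =
    A i j * x j ^+ 2 - (2 * y) * (A i j * x j) + A i j * y ^+ 2 by ring.
rewrite (eq_bigr _ (fun j _ => E j)) big_split sumrB /= -mulr_sumr -mulr_suml.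
by rewrite A1 -/y; ring.
Qed.

(** Each row loses exactly its variance (row sums 1), and the averaged squares add up again to the
    total (column sums 1). *)
Lemma doubly_stochastic_sumsq A x : doubly_stochastic A ->
  \sum_i (\sum_j A i j * x j) ^+ 2 =
  \sum_j x j ^+ 2 - \sum_i \sum_j A i j * (x j - \sum_k A i k * x k) ^+ 2.
Proof.
move=> [A0 Ar Ac].
under [X in _ - X]eq_bigr => i _ do rewrite row_variance ?Ar //.
rewrite sumrB exchange_big /=.
under [X in _ - (X - _)]eq_bigr => j _ do rewrite -mulr_suml Ac mul1r.
by ring.
Qed.

Lemma doubly_stochastic_sumsq_le A x : doubly_stochastic A ->
  \sum_i (\sum_j A i j * x j) ^+ 2 <= \sum_j x j ^+ 2.
Proof.
move=> dA; have [A0 _ _] := dA; rewrite doubly_stochastic_sumsq // gerBl.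
by apply: sumr_ge0 => i _; apply: sumr_ge0 => j _; rewrite mulr_ge0 ?sqr_ge0.
Qed.

(* Pigeonhole: [x i0] lies in none of the [n] disjoint open intervals that cut
   [x i0, x i1], so the [n] points cannot meet them all. *)
Lemma exists_gap x i0 i1 : (forall i, x i0 <= x i) ->
  let h := (x i1 - x i0) / n%:R in
  exists a, [/\ x i0 <= a, a + h <= x i1
    & forall i, x i <= a \/ a + h <= x i].
Proof.
move=> x0 h.
have n0 : 0 < n%:R :> R by rewrite ltr0n (leq_trans _ (ltn_ord i0)).
have h0 : 0 <= h by rewrite divr_ge0 ?subr_ge0 // ltW.
have hn : x i0 + n%:R * h = x i1 by rewrite mulrC divfK ?gt_eqF // addrC subrK.
have [[k Hk]|H] := pselect (exists k : 'I_n, forall i,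
    x i <= x i0 + k%:R * h \/ x i0 + k%:R * h + h <= x i).
  exists (x i0 + k%:R * h); split => //.
    by rewrite lerDl mulr_ge0.
  rewrite -hn -addrA lerD2l -[X in _ + X]mul1r -mulrDl natr1 ler_wpM2r //.
  by rewrite ler_nat.
have {}H (k : 'I_n) : {i | x i0 + k%:R * h < x i < x i0 + k.+1%:R * h}.
  apply: cid; apply: contrapT => Hk; apply: H; exists k => i.
  apply/orP; rewrite -[_ || _]negbK negb_or -!ltNge; apply/negP => K; apply: Hk.
  by exists i; rewrite -natr1 mulrDl mul1r addrA.
pose f k := sval (H k).
have finj : injective f.
  suff le (j k : 'I_n) : f j = f k -> (j <= k)%N.
    by move=> j k E; apply/val_inj/anti_leq; rewrite !le.
  move=> E; have /andP[J _] := svalP (H j); have /andP[_] := svalP (H k).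
  rewrite -/(f k) -E => K; move: (lt_trans J K).
  rewrite ltrD2l => L; have := le_lt_trans (_ : 0 <= _) L.
  have hp : 0 < h.
    rewrite lt_neqAle h0 andbT eq_sym; apply/eqP => hz; move: L.
    by rewrite hz !mulr0 ltxx.
  by move: L; rewrite ltr_pM2r // ltr_nat ltnS.
have /codomP[k Ek] := injF_onto finj i0.
have /andP[] := svalP (H k); rewrite -/(f k) -Ek.
by rewrite ltNge lerDl mulr_ge0.
Qed.

(** * Energy lost over [iota] rounds of a jointly connected graph *)

Section Crossing.
Variables (A : nat -> 'M[R]_n) (E : nat -> rel 'I_n) (w : R) (iota : nat).
Hypothesis w0 : 0 <= w.
Hypothesis A_ds : forall l, doubly_stochastic (A l).
Hypothesis A_diag : forall l i, w <= A l i i.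
Hypothesis A_edge : forall l i j, E l j i -> w <= A l i j.
Hypothesis A_nedge : forall l i j, ~~ E l j i -> i != j -> A l i j = 0.
Hypothesis E_conn : forall i j,
  connect (fun u v => [exists l : 'I_iota, E l u v]) i j.
Variable x : nat -> 'I_n -> R.
Hypothesis x_step : forall l i, x l.+1 i = \sum_j A l i j * x l j.

Let sq l := \sum_i x l i ^+ 2.

Lemma sumsq_step l :
  sq l - sq l.+1 = \sum_i \sum_j A l i j * (x l j - x l.+1 i) ^+ 2.
Proof.
rewrite /sq; under [X in _ - X]eq_bigr => i _ do rewrite x_step.
rewrite doubly_stochastic_sumsq // opprB addrC subrK.
by apply: eq_bigr => i _; apply: eq_bigr => j _; rewrite x_step.
Qed.

Lemma sumsq_noninc l k : (l <= k)%N -> sq k <= sq l.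
Proof.
move=> /subnK <-; elim: (k - l)%N => [|d IH]; first by rewrite add0n.
apply: le_trans IH; rewrite addSn -subr_ge0 sumsq_step.
by apply: sumr_ge0 => i _; apply: sumr_ge0 => j _;
  have [+ _ _] := A_ds (d + l); move=> A0; rewrite mulr_ge0 ?sqr_ge0.
Qed.

(* Up to the first time [l] at which an edge joins the two sides of the largest
   gap, the values stay on their side; at time [l] the head of that edge
   averages two values at distance at least [h]. *)
Lemma gap_decrease i0 i1 : (forall i, x 0 i0 <= x 0 i) ->
  w / 2 * ((x 0 i1 - x 0 i0) / n%:R) ^+ 2 <= sq 0 - sq iota.
Proof.
move=> x0; have [a []] := exists_gap i1 x0; set h := _ / _ => a0 a1 ax.
have n0 : 0 < n%:R :> R by rewrite ltr0n (leq_trans _ (ltn_ord i0)).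
have h0 : 0 <= h.
  by rewrite divr_ge0 ?subr_ge0 // ltW.
have [hz|hnz] := eqVneq h 0.
  by rewrite hz expr0n mulr0 subr_ge0 sumsq_noninc.
have hp : 0 < h by rewrite lt_neqAle eq_sym hnz.
pose L := [pred i | x 0 i <= a].
have LN i : i \notin L -> a + h <= x 0 i.
  by rewrite inE -ltNge => ai; have [] := ax i => //; rewrite leNgt ai.
have LN1 : i1 \notin L by rewrite inE -ltNge; lra.
pose cross l := [exists u, [exists v, E l u v && ((u \in L) != (v \in L))]].
(* Otherwise [L] would be closed under the union graph, although a path leads from [i0] in [L] to
   [i1] outside it. *)
have ex_cross : exists l, (l < iota)%N && cross l.
  apply: contrapT => NC.
  suff cl : fingraph.closed (fun u v => [exists l : 'I_iota, E l u v]) L.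
    have := closed_connect cl (E_conn i0 i1).
    by rewrite (negbTE LN1) inE a0.
  move=> u v /existsP[l Euv]; apply/eqP/negPn/negP => ne; apply: NC.
  exists l; rewrite ltn_ord; apply/existsP; exists u.
  by apply/existsP; exists v; rewrite Euv.
case: (ex_minnP ex_cross) => l /andP[li Cl] lmin.
have side k : (k <= l)%N ->
    forall i, if i \in L then x k i <= a else a + h <= x k i.
  elim: k => [_ i|k IH kl i].
    by case: ifPn => [//|/LN].
  have kn u v : E k u v -> (u \in L) = (v \in L).
    move=> Euv; apply/eqP/negPn/negP => ne.
    suff : (l <= k)%N by rewrite leqNgt kl.
    apply: lmin; rewrite (ltn_trans kl li) /=.
    by apply/existsP; exists u; apply/existsP; exists v; rewrite Euv.
  have [A0 A1 _] := A_ds k.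
  have only j : (j \in L) != (i \in L) -> A k i j = 0.
    move=> ne; apply: A_nedge; last by apply: contraNneq ne => ->.
    by apply: contraNN ne => /kn ->.
  rewrite x_step; case: ifPn => iL.
    rewrite -[leRHS]mul1r -(A1 i) mulr_suml; apply: ler_sum => j _.
    have [jL|jL] := boolP (j \in L).
      by rewrite ler_wpM2l //; have := IH (ltnW kl) j; rewrite jL.
    by rewrite only ?mul0r // iL (negbTE jL).
  rewrite -[leLHS]mul1r -(A1 i) mulr_suml; apply: ler_sum => j _.
  have [jL|jL] := boolP (j \in L).
    by rewrite only ?mul0r // jL (negbTE iL).
  by rewrite ler_wpM2l //; have := IH (ltnW kl) j; rewrite (negbTE jL).
have [u /existsP[v /andP[Euv ne]]] := existsP Cl.
have uv : u != v by apply: contraNneq ne => ->.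
have far : h ^+ 2 <= (x l u - x l v) ^+ 2.
  have := side l (leqnn _) u; have := side l (leqnn _) v; move: ne.
  by do 2 case: ifP => _ //; nra.
apply: (@le_trans _ _ (sq l - sq l.+1)); last first.
  by apply: lerB; apply: sumsq_noninc.
have [A0 _ _] := A_ds l.
(* Of the double sum only row [v] with columns [v] and [u] is kept. Both weights are at least [w],
   and since [x l u] and [x l v] are [h] apart, [y] cannot be close to both; this is the
   parallelogram inequality [e4]. *)
rewrite sumsq_step (bigD1 v) //= (bigD1 v) //= (bigD1 u) //=.
set rest1 := \sum_(j | _) _; set rest2 := \sum_(i | _) _.
have r1 : 0 <= rest1 by apply: sumr_ge0 => j _; rewrite mulr_ge0 ?sqr_ge0.
have r2 : 0 <= rest2.
  by apply: sumr_ge0 => i _; apply: sumr_ge0 => j _; rewrite mulr_ge0 ?sqr_ge0.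
set y := x l.+1 v.
have e1 : w * (x l v - y) ^+ 2 <= A l v v * (x l v - y) ^+ 2.
  by rewrite ler_wpM2r ?sqr_ge0.
have e2 : w * (x l u - y) ^+ 2 <= A l v u * (x l u - y) ^+ 2.
  by rewrite ler_wpM2r ?sqr_ge0 // A_edge.
have e3 : w * h ^+ 2 <= w * (x l u - x l v) ^+ 2 by rewrite ler_wpM2l.
have e4 : w * (x l u - x l v) ^+ 2 <=
    2 * (w * (x l v - y) ^+ 2 + w * (x l u - y) ^+ 2).
  rewrite -mulrDr [leRHS]mulrCA ler_wpM2l // -subr_ge0.
  by rewrite (_ : _ - _ = (x l u + x l v - 2 * y) ^+ 2) ?sqr_ge0 //; ring.
rewrite (_ : w / 2 * h ^+ 2 = w * h ^+ 2 / 2); last by ring.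
by lra.
Qed.

(** With zero mean the energy is at most [n] times the squared range, while [gap_decrease] removes
    [w / 2] times the squared range over [n ^ 2]; the ratio produces [n ^ 3]. *)
Lemma sumsq_contraction : \sum_i x 0 i = 0 ->
  sq iota <= (1 - w / (2 * n%:R ^+ 3)) * sq 0.
Proof.
move=> x_sum0; have [i0 _|nI] := pickP (fun _ : 'I_n => true); last first.
  by rewrite /sq !big1 ?mulr0 // => i; have := nI i.
have n0 : 0 < n%:R :> R by rewrite ltr0n (leq_trans _ (ltn_ord i0)).
have [a _ amin] := Order.TotalTheory.arg_minP (x 0) (erefl (xpredT i0)).
have [b _ bmax] := Order.TotalTheory.arg_maxP (x 0) (erefl (xpredT i0)).
have := @gap_decrease a b (fun i => amin i isT).
set h := x 0 b - x 0 a => D.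
have V : sq 0 <= n%:R * h ^+ 2.
  have -> : sq 0 = \sum_i (x 0 i - x 0 a) ^+ 2 - n%:R * x 0 a ^+ 2.
    have S i : (x 0 i - x 0 a) ^+ 2 =
      x 0 i ^+ 2 - (2 * x 0 a) * x 0 i + x 0 a ^+ 2 by ring.
    rewrite (eq_bigr _ (fun i _ => S i)) big_split sumrB /= -mulr_sumr x_sum0.
    by rewrite sumr_const card_ord -mulr_natl /sq; ring.
  rewrite lerBlDr; apply: ler_wpDr; first by rewrite mulr_ge0 ?sqr_ge0 // ltW.
  rewrite mulr_natl -[X in _ *+ X](card_ord n) -sumr_const.
  apply: ler_sum => i _; have := amin i isT; have := bmax i isT => bi ai.
  by rewrite ler_pXn2r ?nnegrE ?subr_ge0 ?lerD2r // (le_trans ai).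
rewrite mulrBl mul1r lerBrDr -lerBrDl; apply: le_trans D.
apply: (@le_trans _ _ (w / (2 * n%:R ^+ 3) * (n%:R * h ^+ 2))).
  by rewrite ler_wpM2l // divr_ge0 // mulr_ge0 // exprn_ge0 // ltW.
rewrite le_eqVlt; apply/orP; left; apply/eqP; field.
by rewrite gt_eqF.
Qed.
End Crossing.

End Consensus.

(** * Accumulated disagreement *)

Section NoiseAccumulation.
Local Set Implicit Arguments.
Local Unset Strict Implicit.
Variable R : realType.

(** Instead of cutting the range into blocks, the sum is compared with itself shifted by [iota]: it
    is at most [iota * e 0] plus [r] times itself, and this is solved for the sum. *)
Lemma block_geometric_sum (e : nat -> R) (r : R) (iota K : nat) :
  (forall k, 0 <= e k) -> (forall k, e k.+1 <= e k) ->
  (forall k, e (k + iota)%N <= r * e k) -> r < 1 ->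
  \sum_(0 <= k < K) e k <= iota%:R / (1 - r) * e 0.
Proof.
move=> e0 edec er r1; have r1' : 0 < 1 - r by rewrite subr_gt0.
have le0 k : e k <= e 0.
  by elim: k => // k IH; apply: le_trans IH; exact: edec.
have S1 : \sum_(0 <= k < iota) e k <= iota%:R * e 0.
  rewrite mulr_natl -[X in _ *+ X](subn0 iota) -sumr_const_nat.
  by apply: ler_sum.
have S2 : \sum_(0 <= k < K) e (k + iota)%N <= r * \sum_(0 <= k < K) e k.
  by rewrite mulr_sumr; apply: ler_sum => k _.
have S3 : \sum_(0 <= k < K) e k <=
    \sum_(0 <= k < iota) e k + \sum_(0 <= k < K) e (k + iota)%N.
  apply: (@le_trans _ _ (\sum_(0 <= k < K + iota) e k)).
    rewrite [leRHS](big_cat_nat (n := K)) ?leq_addr //= lerDl.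
    by rewrite sumr_ge0.
  rewrite (big_cat_nat (n := iota)) ?leq_addl //= lerD2l.
  by rewrite -{1}(add0n iota) big_addn addnK.
rewrite mulrAC ler_pdivlMr // mulrBr mulr1 mulrC lerBlDr.
by apply: (le_trans S3); exact: lerD.
Qed.

(** The order of summation is exchanged, [k = t + 1 - s] becomes the inner index, and its range is
    enlarged by nonnegative terms. *)
Lemma triangle_sum (F : nat -> nat -> R) T : (forall s k, 0 <= F s k) ->
  \sum_(1 <= t < T.+1) \sum_(1 <= s < t.+1) F s (t.+1 - s)%N
    <= \sum_(1 <= s < T.+1) \sum_(0 <= k < T.+1) F s k.
Proof.
move=> F0.
rewrite (eq_big_nat _ _ (F2 := fun t => \sum_(1 <= s < T.+1)
    if (s <= t)%N then F s (t.+1 - s)%N else 0)); last first.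
  move=> t /andP[_ tT]; rewrite (big_nat_widen _ _ T.+1) // big_mkcond /=.
  by apply: eq_bigr => s _; rewrite ltnS.
rewrite exchange_big_nat /= ler_sum_nat // => s /andP[s1 sT].
rewrite (big_cat_nat (n := s)) //= 1?ltnW //.
rewrite big_nat_cond big1 ?add0r => [|t /andP[/andP[_ ts] _]]; last first.
  by rewrite leqNgt ts.
rewrite -{1}(add0n s) big_addn.
rewrite [leRHS](big_cat_nat (n := (T.+1 - s).+1)) //=; last by lia.
rewrite big_nat_recl //= -[leLHS]add0r -addrA lerD //.
rewrite -[leLHS]addr0 lerD //; last by rewrite sumr_ge0.
by apply: ler_sum => k _; rewrite leq_addl subSn ?leq_addl // addnK.
Qed.

(** * Frobenius geometry of the stacked dual variables *)

Variables (n m : nat).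
Implicit Types B G : 'M[R]_(n, m).

Definition frob B G : R := \sum_i \sum_k B i k * G i k.

Definition fnorm B : R := Num.sqrt (frob B B).

Lemma frob_ge0 B : 0 <= frob B B.
Proof. by do 2 (apply: sumr_ge0 => ? _); rewrite -expr2 sqr_ge0. Qed.

Lemma fnorm_ge0 B : 0 <= fnorm B. Proof. exact: sqrtr_ge0. Qed.

Lemma sqr_fnorm B : fnorm B ^+ 2 = frob B B.
Proof. by rewrite sqr_sqrtr ?frob_ge0. Qed.

Lemma frob_le_fnorm B G : frob B G <= fnorm B * fnorm G.
Proof.
apply: (le_trans (ler_norm _)).
rewrite -(@ler_pXn2r _ 2) ?nnegrE ?mulr_ge0 ?fnorm_ge0// exprMn !sqr_fnorm.
rewrite real_normK ?num_real // /frob !pair_bigA /=.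
apply: (le_trans (@cauchy_schwarz_sum R _
  (fun p => B p.1 p.2) (fun p => G p.1 p.2))).
by apply: ler_pM; rewrite ?sumr_ge0 // => p _; rewrite sqr_ge0.
Qed.

Lemma frob_suml (I : Type) (r : seq I) (Q : pred I) (B : I -> 'M[R]_(n, m)) G :
  frob (\sum_(i <- r | Q i) B i) G = \sum_(i <- r | Q i) frob (B i) G.
Proof.
apply: (big_morph (fun Z => frob Z G)) => [B1 B2|].
  rewrite /frob -big_split; apply: eq_bigr => i _; rewrite -big_split.
  by apply: eq_bigr => k _; rewrite mxE mulrDl.
by rewrite /frob big1 // => i _; rewrite big1 // => k _; rewrite mxE mul0r.
Qed.

(** Rows are agents and columns are constraints, so this is the projection orthogonal to the
    consensus direction, one constraint at a time. *)
Definition centered B : 'M[R]_(n, m) :=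
  \matrix_(i < n, k < m) (B i k - (\sum_j B j k) / n%:R).

Lemma centeredE B i k : centered B i k = B i k - (\sum_j B j k) / n%:R.
Proof. exact: mxE. Qed.

Lemma centeredD B G : centered (B + G) = centered B + centered G.
Proof.
apply/matrixP => i k; rewrite [RHS]mxE !centeredE mxE.
under eq_bigr => j _ do rewrite mxE.
by rewrite big_split /= mulrDl; ring.
Qed.

Lemma centered0 : centered 0 = 0.
Proof.
apply/matrixP => i k; rewrite centeredE big1 => [|j _]; rewrite mxE //.
by rewrite mul0r subrr.
Qed.

Lemma centered_mulmx (A : 'M[R]_n) B :
  doubly_stochastic A -> centered (A *m B) = A *m centered B.
Proof.
move=> [_ Ar Ac]; apply/matrixP => i k; rewrite centeredE 2!mxE.
under [X in _ - X / _]eq_bigr => j _ do rewrite mxE.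
rewrite exchange_big /=.
under [X in _ - X / _]eq_bigr => j _ do rewrite -mulr_suml Ac mul1r.
under [RHS]eq_bigr => j _ do rewrite centeredE mulrBr.
by rewrite sumrB -[in RHS]mulr_suml Ar mul1r.
Qed.

Lemma sum_centered B k : (0 < n)%N -> \sum_i centered B i k = 0.
Proof.
move=> n0; under eq_bigr => i _ do rewrite centeredE.
rewrite sumrB sumr_const card_ord -[_ *+ n]mulr_natr divfK ?subrr //.
by rewrite pnatr_eq0 -lt0n.
Qed.

Lemma fnorm_centered B : (0 < n)%N -> fnorm (centered B) <= fnorm B.
Proof.
move=> n0; apply: ler_wsqrtr; rewrite /frob exchange_big [leRHS]exchange_big.
apply: ler_sum => k _ /=; set c := (\sum_j B j k) / n%:R.
have E i : centered B i k * centered B i k =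
    B i k * B i k - c * B i k - c * centered B i k.
  by rewrite centeredE -/c; ring.
rewrite (eq_bigr _ (fun i _ => E i)) !sumrB -!mulr_sumr sum_centered // mulr0.
rewrite subr0 gerBl /c mulrAC -expr2 divr_ge0 // sqr_ge0 //.
Qed.

(** * Damping of noise by successive mixing matrices *)

Section Propagation.
Variables (E : nat -> rel 'I_n) (W : nat -> 'M[R]_n) (w : R) (iota : nat).
Hypothesis Hgraph : graph_assumption E W w iota.

Fixpoint propagate s B k : 'M[R]_(n, m) :=
  if k is k'.+1 then W (s + k') *m propagate s B k' else B.

Lemma fnorm_propagate_noninc s B k : (0 < s)%N ->
  fnorm (propagate s B k.+1) <= fnorm (propagate s B k).
Proof.
move=> s0; apply: ler_wsqrtr; rewrite /frob exchange_big [leRHS]exchange_big.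
apply: ler_sum => c _ /=.
have dW : doubly_stochastic (W (s + k)).
  by apply: (W_stoch Hgraph); rewrite addn_gt0 s0.
apply: le_trans (doubly_stochastic_sumsq_le (fun j => propagate s B k j c) dW).
by apply: ler_sum => i _; rewrite mxE expr2.
Qed.

Lemma propagateD s B k l :
  propagate s B (k + l) = propagate (s + k) (propagate s B k) l.
Proof. by elim: l => [|l IH]; rewrite ?addn0 // addnS /= IH addnA. Qed.

Lemma sum_propagate s B k c : (0 < s)%N ->
  \sum_i propagate s B k i c = \sum_i B i c.
Proof.
move=> s0; elim: k => //= k <-.
have [_ _ Ac] : doubly_stochastic (W (s + k)).
  by apply: (W_stoch Hgraph); rewrite addn_gt0 s0.
under eq_bigr => i _ do rewrite mxE.
by rewrite exchange_big /=; apply: eq_bigr => j _; rewrite -mulr_suml Ac mul1r.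
Qed.

Lemma frob_contraction s B : (0 < s)%N -> (forall c, \sum_i B i c = 0) ->
  frob (propagate s B iota) (propagate s B iota)
    <= (1 - w / (2 * n%:R ^+ 3)) * frob B B.
Proof.
move=> s0 B0; rewrite /frob exchange_big [in leRHS]exchange_big mulr_sumr.
apply: ler_sum => c _ /=.
have [w0 w1] := andP (w_range Hgraph).
have sl l : (0 < s + l)%N by rewrite addn_gt0 s0.
have := @sumsq_contraction R n (fun l => W (s + l)) (fun l => E (s + l)) w iota
  (ltW w0) _ _ _ _ _ (fun l i => propagate s B l i c) _ (B0 c).
rewrite /= => H; apply: H => [l|l i|l i j Eij|l i j Eij ij|i j|l i].
- exact: (W_stoch Hgraph).
- by apply: (W_ge Hgraph) => //; apply: (W_pos Hgraph) => //; rewrite eqxx orbT.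
- by apply: (W_ge Hgraph) => //; apply: (W_pos Hgraph) => //; rewrite Eij.
- by apply: (W_zero Hgraph) => //; rewrite negb_or Eij.
- exact: (E_connected Hgraph).
- by rewrite mxE.
Qed.

(** Passing from squares to norms halves the rate, by [1 - 2 * u <= (1 - u) ^ 2]. Mixing keeps
    column sums equal to zero, so the contraction can be restarted at any [k]. *)
Lemma fnorm_contraction s B k : (0 < n)%N -> (0 < s)%N ->
  (forall c, \sum_i B i c = 0) ->
  fnorm (propagate s B (k + iota))
    <= (1 - w / (4 * n%:R ^+ 3)) * fnorm (propagate s B k).
Proof.
move=> n0 s0 B0; have [w0 w1] := andP (w_range Hgraph).
have n3 : 1 <= n%:R ^+ 3 :> R by rewrite exprn_ege1 // ler1n.
set u := w / (4 * n%:R ^+ 3).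
have u2 : w / (2 * n%:R ^+ 3) = 2 * u.
  by rewrite /u; field; rewrite gt_eqF // ltr0n.
have u0 : 0 <= u by rewrite divr_ge0 ?ltW // mulr_gt0 // (lt_le_trans _ n3).
have u1 : u <= 1.
  have n4 : 0 < 4 * n%:R ^+ 3 :> R by lra.
  by rewrite ler_pdivrMr // mul1r; lra.
rewrite -(@ler_pXn2r _ 2) ?nnegrE ?mulr_ge0 ?fnorm_ge0 ?subr_ge0 //.
rewrite exprMn !sqr_fnorm propagateD.
have := @frob_contraction (s + k) (propagate s B k).
rewrite addn_gt0 s0 => /(_ isT) C.
apply: le_trans (C _) _ => [c|]; first by rewrite sum_propagate.
rewrite u2 ler_wpM2r ?frob_ge0 //; nra.
Qed.

Lemma sum_fnorm_propagate s B K : (0 < n)%N -> (0 < s)%N ->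
  (forall c, \sum_i B i c = 0) ->
  \sum_(0 <= k < K) fnorm (propagate s B k)
    <= 4 * n%:R ^+ 3 * iota%:R / w * fnorm B.
Proof.
move=> n0 s0 B0; have [w0 w1] := andP (w_range Hgraph).
have n3 : 0 < n%:R ^+ 3 :> R by rewrite exprn_gt0 // ltr0n.
have := @block_geometric_sum (fun k => fnorm (propagate s B k))
  (1 - w / (4 * n%:R ^+ 3)) iota K (fun k => fnorm_ge0 _)
  (fun k => fnorm_propagate_noninc B k s0)
  (fun k => fnorm_contraction k n0 s0 B0).
have n4 : 0 < 4 * n%:R ^+ 3 :> R by lra.
rewrite gtrBl divr_gt0 // subKr => /(_ isT) /= H.
apply: (le_trans H); rewrite le_eqVlt; apply/orP; left; apply/eqP; field.
by rewrite !gt_eqF // ltr0n.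
Qed.

(** Unrolls the recursion; [eps s] is first mixed by [W s], hence it has passed through [T + 1 - s]
    matrices when it reaches [q T.+1]. *)
Lemma centered_expansion (q eps : nat -> 'M[R]_(n, m)) T :
  q 1%N = 0 -> (forall t, (0 < t)%N -> q t.+1 = W t *m (q t + eps t)) ->
  centered (q T.+1) =
  \sum_(1 <= s < T.+1) propagate s (centered (eps s)) (T.+1 - s).
Proof.
move=> q1 qS; elim: T => [|T IH]; first by rewrite q1 centered0 big_geq.
rewrite qS // centered_mulmx; last exact: (W_stoch Hgraph).
rewrite centeredD IH mulmxDr [in RHS]big_nat_recr //=; congr (_ + _); last first.
  by rewrite subSnn /= addn0.
rewrite mulmx_sumr; apply: eq_big_nat => s /andP[s1 sT].
by rewrite [(T.+2 - s)%N]subSn ?(ltnW sT) //= subnKC // ltnW.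
Qed.

(* The noise [eps s] injected at time [s] is damped geometrically. *)
Lemma disagreement_sum (q eps G : nat -> 'M[R]_(n, m)) (c : R) (b : nat -> R) T :
  (0 < n)%N -> 0 <= c ->
  q 1%N = 0 -> (forall t, (0 < t)%N -> q t.+1 = W t *m (q t + eps t)) ->
  (forall t, (0 < t)%N -> fnorm (eps t) <= b t) ->
  (forall t, (0 < t)%N -> fnorm (G t) <= c) ->
  \sum_(1 <= t < T.+1) frob (centered (q t.+1)) (G t)
    <= c * (4 * n%:R ^+ 3 * iota%:R / w) * \sum_(1 <= t < T.+1) b t.
Proof.
move=> n0 c0 q1 qS epsb Gc; have [w0 w1] := andP (w_range Hgraph).
pose e s k := fnorm (propagate s (centered (eps s)) k).
apply: (@le_trans _ _
    (\sum_(1 <= t < T.+1) \sum_(1 <= s < t.+1) c * e s (t.+1 - s)%N)).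
  apply: ler_sum_nat => t /andP[t1 _].
  rewrite (centered_expansion _ q1 qS) frob_suml; apply: ler_sum_nat => s _.
  apply: (le_trans (frob_le_fnorm _ _)).
  by rewrite mulrC ler_wpM2r ?fnorm_ge0 ?Gc.
apply: (le_trans (@triangle_sum (fun s k => c * e s k) T _)) => [s k|].
  by rewrite mulr_ge0 ?fnorm_ge0.
rewrite mulr_sumr; apply: ler_sum_nat => s /andP[s1 _].
rewrite -mulr_sumr -mulrA ler_wpM2l //.
apply: (le_trans (sum_fnorm_propagate _ n0 s1 _)) => [k|].
  exact: sum_centered.
rewrite ler_wpM2l ?(le_trans (fnorm_centered _ n0)) ?epsb //.
by rewrite divr_ge0 ?(ltW w0) // !mulr_ge0 ?exprn_ge0.
Qed.
End Propagation.
End NoiseAccumulation.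

(** * The mirror step *)

Section MirrorStep.
Local Set Implicit Arguments.
Local Unset Strict Implicit.
Variable R : realType.

(** The minimiser is compared with a point slightly towards [y]. Convexity handles [r], the
    first-order expansion handles [psi]; after division by the step length only an arbitrarily small
    error is left. *)
Lemma argmin_first_order k (X : set 'cV[R]_k) (c : R) (l v x y : 'cV[R]_k)
    (r psi : 'cV[R]_k -> R) :
  @convex_set R 'cV[R]_k X -> @convex_function R 'cV[R]_k X r -> 0 <= c ->
  gradient_within X psi x v ->
  argmin_on X (fun z => dot l z + c * r z + psi z) x -> X y ->
  0 <= dot (l + v) (y - x) + c * (r y - r x).
Proof.
move=> cX cr c0 grad [Xx xmin] Xy.
set N := enorm (y - x); have N0 : 0 <= N := enorm_ge0 _.
apply/ler_addgt0Pl => e e0.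
(* The expansion error is this number times [s * N], thus at most [s * e]; the [+ 1] covers
   [N = 0]. *)
have e'0 : 0 < e / (N + 1) by rewrite divr_gt0 //; lra.
have /nbhs_ballP[d /= d0 near_x] := grad _ e'0.
(* Chosen to be at most 1, so that [z] is a convex combination, and to satisfy [s * N < d], so that
   [z] lies in the ball. *)
pose s := d / (d + N + 1).
have s0 : 0 < s by rewrite divr_gt0 //; lra.
have s1 : s <= 1 by rewrite ler_pdivrMr; lra.
have sN : s * N < d by rewrite mulrAC ltr_pdivrMr ?ltr_pM2l //; lra.
pose t : {i01 R} := Itv01 (ltW s0) s1.
pose z := x + s *: (y - x).
have Ez : conv t (y : convex_lmodType _) (x : convex_lmodType _) = z.
  transitivity (s *: y + (1 - s) *: x : 'cV[R]_k); first by [].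
  by rewrite /z scalerBr scalerBl scale1r addrCA.
have Xz : X z by have := cX _ _ t (mem_set Xy) (mem_set Xx); rewrite Ez inE.
have rz : r z <= s * r y + (1 - s) * r x.
  by have := cr t y x (mem_set Xy) (mem_set Xx); rewrite Ez.
have zx : z - x = s *: (y - x) by rewrite /z addrC addKr.
have := near_x z _ Xz; rewrite zx dotZr enormZ (ger0_norm (ltW s0)) -/N.
have bz : ball x d z.
  split=> // i j; rewrite /z !mxE (ord1 j) /ball /= opprD addrA subrr sub0r.
  rewrite normrN normrM gtr0_norm //; apply: le_lt_trans sN; rewrite ler_pM2l //.
  by have := enorm_ge_coord (y - x) i; rewrite !mxE.
move=> /(_ bz); have := xmin z Xz; rewrite /z dotDr dotZr -/z dotDl.
set dl := dot l (y - x); set dv := dot v (y - x) => M.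
rewrite ler_norml => /andP[_ P].
have Q : s * (e / (N + 1) * N) <= s * e.
  rewrite ler_pM2l // mulrAC ler_pdivrMr; last by lra.
  by rewrite ler_pM2l //; lra.
have crz : c * r z <= c * (s * r y + (1 - s) * r x) by rewrite ler_wpM2l.
rewrite -(pmulr_rge0 _ s0); lra.
Qed.

End MirrorStep.

(** * Analysis of the algorithm *)

Section GraphConstant.
Variables (R : realType) (n iota : nat) (w : R).
Hypotheses (n_gt0 : (0 < n)%N) (iota_gt0 : (0 < iota)%N) (w_range : 0 < w < 1).

Let u := w / (2 * n%:R ^+ 2).

Let u_range : 0 < u < 1.
Proof.
have [w0 w1] := andP w_range.
have n2 : 1 <= n%:R ^+ 2 :> R by rewrite exprn_ege1 // ler1n.
apply/andP; split; first by rewrite divr_gt0 //; lra.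
by rewrite ltr_pdivrMr; lra.
Qed.

Lemma lambda_exp : lambda n iota w ^+ iota = 1 - w / (2 * n%:R ^+ 2).
Proof.
have [u0 u1] := andP u_range.
rewrite /lambda -powR_mulrn ?powR_ge0 // -powRrM div1r mulVf ?powRr1 //.
  by rewrite subr_ge0 ltW.
by rewrite pnatr_eq0 -lt0n.
Qed.

Lemma lambda_range : 0 <= lambda n iota w < 1.
Proof.
have [u0 u1] := andP u_range; rewrite powR_ge0 /= ltNge; apply/negP => l1.
by have := exprn_ege1 iota l1; rewrite lambda_exp -/u; lra.
Qed.

(** With [rho = lambda ^ iota = 1 - u], one has [tau = rho ^ (-2)] and the left side is
    [2 * n * iota / u]. The claim then follows from [iota * (1 - lambda) * rho <= u], which is
    [root_gap], and [rho < 1]. *)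
Lemma graph_constant_le :
  4 * n%:R ^+ 3 * iota%:R / w <= 3 * n%:R * tau n w / (1 - lambda n iota w).
Proof.
have [w0 w1] := andP w_range; have [u0 u1] := andP u_range.
have [l0 l1] := andP lambda_range.
have n0 : 0 < n%:R :> R by rewrite ltr0n.
have := @root_gap R (lambda n iota w) iota.
rewrite l0 (ltW l1) lambda_exp -/u subKr => /(_ isT).
set g := 1 - lambda n iota w; have g0 : 0 < g by rewrite subr_gt0.
rewrite (_ : tau n w = ((1 - u) ^+ 2)^-1) //.
have [rho Erho] : exists rho, rho = 1 - u by exists (1 - u).
rewrite -Erho => H; have r0 : 0 < rho by rewrite Erho subr_gt0.
have r1 : rho < 1 by lra.
have -> : 4 * n%:R ^+ 3 * iota%:R / w = 2 * n%:R * iota%:R / u.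
  by rewrite /u; field; rewrite !gt_eqF.
have -> : 3 * n%:R / rho ^+ 2 / g = 3 * n%:R / (rho ^+ 2 * g).
  by field; rewrite !gt_eqF.
have rg0 : 0 < rho ^+ 2 * g by rewrite mulr_gt0 // exprn_gt0.
rewrite ler_pdivlMr // mulrAC ler_pdivrMr //.
have nr : 0 <= 2 * n%:R * rho by rewrite !mulr_ge0 // ltW.
have := ler_wpM2l nr H; have : n%:R * u * rho <= n%:R * u * 1.
  by rewrite ler_wpM2l ?(ltW r1) // mulr_ge0 // ltW.
have : 0 <= n%:R * u by rewrite mulr_ge0 // ltW.
by lra.
Qed.
End GraphConstant.

(** Abel summation; the induction carries the sharper bound [c T.+1 * (A - D T.+1)], whose last
    factor is nonnegative and so survives the growth of [c]. *)
Lemma weighted_telescope (R : realType) (c D : nat -> R) (A : R) T :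
  (forall t, 0 <= c t) -> (forall t, c t <= c t.+1) ->
  (forall t, 0 <= D t <= A) ->
  \sum_(1 <= t < T.+1) c t.+1 * (D t - D t.+1) <= c T.+1 * A.
Proof.
move=> c0 cinc DA.
suff H : \sum_(1 <= t < T.+1) c t.+1 * (D t - D t.+1) <= c T.+1 * (A - D T.+1).
  apply: (le_trans H); rewrite ler_wpM2l // gerBl.
  by have /andP[] := DA T.+1.
elim: T => [|T IH].
  by rewrite big_geq // mulr_ge0 // subr_ge0; have /andP[] := DA 1%N.
rewrite big_nat_recr //=; apply: (le_trans (lerD IH (lexx _))).
have AD : 0 <= A - D T.+1 by rewrite subr_ge0; have /andP[] := DA T.+1.
have := ler_wpM2r AD (cinc T.+1); lra.
Qed.

Section Algorithm.
Variables (R : realType) (n m : nat) (n_gt0 : (0 < n)%N).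
Variables (p : 'I_n -> nat) (P : problem R m p) (M : mirror R p).
Variables (E : nat -> rel 'I_n) (W : nat -> 'M[R]_n).
Variables (Phi : forall i, nat -> 'cV[R]_(p i) -> 'cV[R]_(p i)).
Variables (w F G K d kappa : R) (iota : nat) (Y : trajectory R m p).
Hypothesis Hstanding : standing P M.
Hypothesis Hgraph : graph_assumption E W w iota.
Hypothesis Hfun : function_assumption P F G.
Hypothesis Hbreg : bregman_lipschitz P M K.
Hypothesis Hd : diameter_bound P d.
Hypothesis Hkappa : 0 < kappa < 1.
Hypothesis HPhi : forall i t z, (0 < t)%N -> X_ P i z -> Phi i t z = z.
Hypothesis Hrun : algorithm_run P M W Phi
  (fun t => 1 / t%:R `^ kappa) (fun t => 1 / t%:R `^ kappa)
  (fun t => 1 / t%:R `^ (1 - kappa)) Y.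

Local Set Implicit Arguments.
Local Unset Strict Implicit.

Let x i t := x_ Y i t.
Let q i t := q_ Y i t.
Let qt i t := qt_ Y i t.
(** Written with [x i t.+1] where the algorithm has [xt_ Y i t.+1]; the two agree because [Phi]
    fixes the points of [X_ P i]. *)
Let b i t : 'cV[R]_m :=
  dg_ P i t (x i t) *m (x i t.+1 - x i t) + g_ P i t (x i t).
(** Reciprocal of [alpha], and of [beta], which is the same sequence; [igamma] is the reciprocal of
    [gamma]. *)
Let ialpha t : R := t%:R `^ kappa.
Let igamma t : R := t%:R `^ (1 - kappa).

(** * Feasibility of the iterates and elementary bounds *)

Let d0 : 0 < d. Proof. by case: Hd. Qed.
Let F0 : 0 < F. Proof. exact: F_gt0 Hfun. Qed.
Let G0 : 0 < G. Proof. exact: G_gt0 Hfun. Qed.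
Let ialpha_gt0 t : 0 < ialpha t.+1. Proof. by rewrite powR_gt0. Qed.
Let igamma_gt0 t : 0 < igamma t.+1. Proof. by rewrite powR_gt0. Qed.
Let ialpha_igamma t : ialpha t.+1 * igamma t.+1 = t.+1%:R.
Proof. exact: powR_nat_compl. Qed.

Lemma xt_mem i t : X_ P i (xt_ Y i t.+1).
Proof. by have [] := xt_step Hrun i t. Qed.

Lemma x_eq_xt i t : x i t.+1 = xt_ Y i t.+1.
Proof. by rewrite /x (x_step Hrun) HPhi //; exact: xt_mem. Qed.

Lemma x_mem i t : X_ P i (x i t).
Proof.
by case: t => [|t]; [exact: (x_init Hrun) | rewrite x_eq_xt; exact: xt_mem].
Qed.

Lemma diameter (i : 'I_n) (y z : Defs.point R p) : prodX P y -> prodX P z ->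
  enorm (y i - z i) <= d.
Proof.
move=> Xy Xz; have [_ H] := Hd; apply: le_trans (H y z Xy Xz).
rewrite -mxcolB; exact: (enorm_mxcol (fun i => y i - z i)).
Qed.

Lemma iterates_mem t : prodX P (iterates Y t).
Proof. by move=> i; exact: x_mem. Qed.

Lemma step_le_d i t : enorm (x i t.+1 - x i t) <= d.
Proof.
exact: (@diameter i (iterates Y t.+1) (iterates Y t)
  (iterates_mem _) (iterates_mem _)).
Qed.

Lemma linearization_le i t k (z : 'cV[R]_(p i)) : (0 < t)%N -> X_ P i z ->
  (dg_ P i t (x i t) *m (z - x i t)) k 0 + g_ P i t (x i t) k 0
    <= g_ P i t z k 0.
Proof.
move=> t0 Xz.
have := @dg_subgrad _ _ _ _ _ _ _ Hfun i t k (x i t) t0 (x_mem _ _) z Xz.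
rewrite addrC; congr (_ + _ <= _); rewrite mxE; apply: eq_bigr => j _.
by rewrite !mxE.
Qed.

Lemma enorm_dg i t (u : 'cV[R]_(p i)) : (0 < t)%N ->
  enorm (dg_ P i t (x i t) *m u) <= G * enorm u.
Proof.
move=> t0; apply: (le_trans (enorm_mulmx _ _)); rewrite ler_wpM2r ?enorm_ge0 //.
by have [] := G_bound Hfun t0 (x_mem i t).
Qed.

Lemma enorm_b i t : (0 < t)%N -> enorm (b i t) <= F + G * d.
Proof.
move=> t0; apply: (le_trans (enormD _ _)); rewrite addrC lerD //.
  by have [] := F_bound Hfun t0 (x_mem i t).
apply: (le_trans (enorm_dg _ t0)); rewrite ler_wpM2l ?(ltW G0) //.
exact: step_le_d.
Qed.

(** * Size of the dual variables and the dual step *)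

Lemma qt_coord i t k : qt i t.+1 k 0 = \sum_j W t i j * q j t k 0.
Proof.
rewrite /qt (qt_step Hrun) summxE; apply: eq_bigr => j _.
by rewrite mxE.
Qed.

(** All data of round 0 vanish, so the first update changes nothing, whatever [W 0] is. The dual
    recursion thus starts at round 1, where the graph assumption begins. *)
Lemma q1_eq0 i : q i 1 = 0.
Proof.
have qt1 : qt_ Y i 1 = 0.
  apply/matrixP => k l; rewrite (ord1 l) (qt_coord i 0 k) mxE big1 // => j _.
  by rewrite /q (q_init Hrun) mxE mulr0.
rewrite /q (q_step Hrun) qt1; have [-> ->] := g_init Hrun (x_init Hrun i).
rewrite mul0mx !addr0 scaler0 subr0 scaler0 addr0.
by apply/matrixP => k l; rewrite !mxE maxxx.
Qed.

Lemma q_ge0 i t k : 0 <= q i t k 0.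
Proof.
case: t => [|t]; first by rewrite /q (q_init Hrun) mxE.
by rewrite /q (q_step Hrun) pospart_ge0.
Qed.

Lemma qt_ge0 i t k : (0 < t)%N -> 0 <= qt i t.+1 k 0.
Proof.
move=> t0; rewrite qt_coord sumr_ge0 // => j _; rewrite mulr_ge0 ?q_ge0 //.
by have [+ _ _] := W_stoch Hgraph t0; apply.
Qed.

Lemma qt_le i t c : (0 < t)%N -> 0 <= c -> (forall j, enorm (q j t) <= c) ->
  enorm (qt i t.+1) <= c.
Proof.
move=> t0 c0 qc; have [W0 Wr _] := W_stoch Hgraph t0.
apply: enorm_le => //.
apply: (@le_trans _ _ (\sum_k \sum_j W t i j * q j t k 0 ^+ 2)).
  apply: ler_sum => k _; rewrite qt_coord -subr_ge0 -row_variance //.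
  by apply: sumr_ge0 => j _; rewrite mulr_ge0 ?sqr_ge0.
rewrite exchange_big /= -[leRHS]mul1r -(Wr i) mulr_suml; apply: ler_sum => j _.
rewrite -mulr_sumr -sqr_enorm ler_wpM2l // ler_pXn2r ?nnegrE ?enorm_ge0 //.
Qed.

(** Rows summing to 1 let the shift by [v] commute with mixing; then the energy of each coordinate
    does not increase. *)
Lemma sum_qt_le t (v : 'cV[R]_m) : (0 < t)%N ->
  \sum_i enorm (qt i t.+1 - v) ^+ 2 <= \sum_i enorm (q i t - v) ^+ 2.
Proof.
move=> t0; have dW := W_stoch Hgraph t0; have [W0 Wr _] := dW.
under eq_bigr => i _ do rewrite sqr_enorm.
under [leRHS]eq_bigr => i _ do rewrite sqr_enorm.
rewrite exchange_big [leRHS]exchange_big /=; apply: ler_sum => k _.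
apply: le_trans (doubly_stochastic_sumsq_le (fun j => (q j t - v) k 0) dW).
apply: ler_sum => i _; rewrite le_eqVlt; apply/orP; left; apply/eqP.
congr (_ ^+ 2); rewrite 2!mxE qt_coord.
under [RHS]eq_bigr => j _ do rewrite 2!mxE mulrBr.
by rewrite sumrB -mulr_suml Wr mul1r.
Qed.

Lemma q_stepE i t : q i t.+1 = pospart (qt i t.+1 + (igamma t.+1)^-1 *:
  (b i t - (ialpha t.+1)^-1 *: qt i t.+1)).
Proof. by rewrite /q (q_step Hrun) !div1r -x_eq_xt. Qed.

(** By convexity the linearisation [b] is at most the value of [g] at the next iterate, which has
    norm at most [F]. The update is then dominated by an average, with weights [1 - gamma * beta]
    and [gamma * beta], of [qt] and a vector of norm at most [F / beta]; the bound [F / beta]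
    therefore reproduces itself. *)
Lemma q_le i t : (0 < t)%N -> enorm (q i t) <= F * ialpha t.
Proof.
case: t => // t _; elim: t i => [|t IH] i.
  by rewrite q1_eq0 enorm0 mulr_ge0 ?ltW.
set a := ialpha t.+2; set c := igamma t.+2.
have ac : a * c = t.+2%:R := ialpha_igamma _.
have a0 : 0 < a := ialpha_gt0 _. have c0 : 0 < c := igamma_gt0 _.
have qtF : enorm (qt i t.+2) <= F * ialpha t.+1.
  by apply: qt_le => //; rewrite mulr_ge0 ?ltW.
have gF : enorm (g_ P i t.+1 (x i t.+2)) <= F.
  by have [] := @F_bound _ _ _ _ _ _ _ Hfun i t.+1 (x i t.+2) isT (x_mem _ _).
set s := 1 - c^-1 * a^-1.
have s0 : 0 <= s.
  rewrite subr_ge0 -invfM mulrC invf_le1 ?mulr_gt0 // ac ler1n //.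
apply: (@le_trans _ _ (s * (F * a) + c^-1 * F)); last first.
  rewrite le_eqVlt; apply/orP; left; apply/eqP; rewrite /s; field.
  by rewrite !gt_eqF.
apply: (@le_trans _ _ (enorm (\col_k (s * qt i t.+2 k 0 +
    c^-1 * `|g_ P i t.+1 (x i t.+2) k 0|)))).
  apply: enorm_mono; apply: ler_sum => k _.
  rewrite ler_pXn2r ?nnegrE ?q_ge0 //; last first.
    by rewrite mxE addr_ge0 // mulr_ge0 ?qt_ge0 // invr_ge0 ltW.
  rewrite q_stepE !mxE ge_max; apply/andP; split; last first.
    by rewrite addr_ge0 // mulr_ge0 ?qt_ge0 // invr_ge0 ltW.
  have L : b i t.+1 k 0 <= `|g_ P i t.+1 (x i t.+2) k 0|.
    apply: le_trans (ler_norm _); rewrite mxE.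
    by apply: linearization_le => //; exact: x_mem.
  rewrite -/a -/c [X in X <= _](_ : _ = s * qt i t.+2 k 0 + c^-1 * b i t.+1 k 0).
    by rewrite lerD2l ler_wpM2l // invr_ge0 ltW.
  by rewrite /s /b !mxE; ring.
pose absg : 'cV[R]_m := \col_k `|g_ P i t.+1 (x i t.+2) k 0|.
rewrite (_ : \col_k _ = s *: qt i t.+2 + c^-1 *: absg); last first.
  by apply/matrixP => k l; rewrite !mxE (ord1 l).
apply: (le_trans (enormD _ _)); rewrite !enormZ (ger0_norm s0).
rewrite ger0_norm ?invr_ge0 ?(ltW c0) // lerD //.
  rewrite ler_wpM2l // (le_trans qtF) // ler_wpM2l ?(ltW F0) //.
  by apply: powR_nat_le => //; apply: ltW; case/andP: Hkappa.
rewrite ler_wpM2l ?invr_ge0 ?(ltW c0) // (le_trans _ gF) //.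
by apply: enorm_mono; apply: ler_sum => k _; rewrite mxE real_normK ?num_real.
Qed.

Let B := B1 F G d.
Let B_ge0 : 0 <= B. Proof. by rewrite /B /B1 addr_ge0 // mulr_ge0 // ltW. Qed.

(** The decay term has norm at most [F] by [q_le]; this is the second [F] in [B1]. *)
Lemma dual_direction_le i t : (0 < t)%N ->
  enorm (b i t - (ialpha t.+1)^-1 *: qt i t.+1) <= B.
Proof.
move=> t0; apply: (le_trans (enormD _ _)); rewrite enormN enormZ.
have a0 := ialpha_gt0 t; rewrite ger0_norm ?invr_ge0 ?(ltW a0) //.
have kp : 0 <= kappa by apply: ltW; case/andP: Hkappa.
have : (ialpha t.+1)^-1 * enorm (qt i t.+1) <= F.
  rewrite mulrC ler_pdivrMr //; apply: qt_le => [//||j].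
    by rewrite mulr_ge0 ?ltW.
  apply: (le_trans (q_le _ t0)); rewrite ler_wpM2l ?(ltW F0) //.
  exact: powR_nat_le.
by have := enorm_b i t0; rewrite /B /B1; lra.
Qed.

Lemma pospart_contract (v z : 'cV[R]_m) : (forall k, 0 <= v k 0) ->
  enorm (pospart z - v) <= enorm (z - v).
Proof.
move=> v0; apply: enorm_mono; apply: ler_sum => k _; rewrite !mxE.
by have := v0 k; case: (lerP (z k 0) 0) => zk vk; nra.
Qed.

Lemma q_noise i t : (0 < t)%N ->
  enorm (q i t.+1 - qt i t.+1) <= (igamma t.+1)^-1 * B.
Proof.
move=> t0; rewrite q_stepE.
apply: (le_trans (pospart_contract _ (fun k => qt_ge0 _ k t0))).
rewrite addrC addKr enormZ ger0_norm ?invr_ge0 ?(ltW (igamma_gt0 _)) //.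
by rewrite ler_wpM2l ?dual_direction_le // invr_ge0 ltW // igamma_gt0.
Qed.

(** The squared distance to [v] after the projected step is expanded and scaled by
    [1 / (2 * gamma)]. Polarisation of the decay term yields [- beta / 2 * |qt - v|^2 + beta / 2 *
    |v|^2], the part in [|qt|^2] being dropped. *)
Lemma dual_step i t (v : 'cV[R]_m) : (0 < t)%N -> (forall k, 0 <= v k 0) ->
  dot v (b i t) - dot (qt i t.+1) (b i t) <=
  (igamma t.+1 - (ialpha t.+1)^-1) / 2 * enorm (qt i t.+1 - v) ^+ 2
  - igamma t.+1 / 2 * enorm (q i t.+1 - v) ^+ 2
  + (ialpha t.+1)^-1 / 2 * enorm v ^+ 2 + (igamma t.+1)^-1 * B ^+ 2 / 2.
Proof.
move=> t0 v0; have a0 := ialpha_gt0 t; have c0 := igamma_gt0 t.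
set a := ialpha t.+1 in a0 *; set c := igamma t.+1 in c0 *.
set u := qt i t.+1; set e := b i t - a^-1 *: u.
have eB : enorm e ^+ 2 <= B ^+ 2.
  by rewrite ler_pXn2r ?nnegrE ?enorm_ge0 // dual_direction_le.
have H : enorm (q i t.+1 - v) ^+ 2 <= enorm (u - v) ^+ 2
    + 2 * c^-1 * (dot (u - v) (b i t) - a^-1 * dot (u - v) u)
    + (c^-1) ^+ 2 * enorm e ^+ 2.
  apply: (@le_trans _ _ (enorm (u - v + c^-1 *: e) ^+ 2)).
    rewrite ler_pXn2r ?nnegrE ?enorm_ge0 // q_stepE.
    by apply: (le_trans (pospart_contract _ v0)); rewrite addrAC.
  rewrite [leLHS]sqr_enormD dotZr enormZ exprMn.
  rewrite real_normK ?num_real // /e dotBr dotZr; lra.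
have uv : 2 * dot (u - v) u = enorm (u - v) ^+ 2 + enorm u ^+ 2 - enorm v ^+ 2.
  by rewrite sqr_enormB dotBl dot_self (dotC v u); ring.
have u2 := sqr_ge0 (enorm u).
have cM : c / 2 * enorm (q i t.+1 - v) ^+ 2 <= c / 2 * enorm (u - v) ^+ 2
    + (dot (u - v) (b i t) - a^-1 * dot (u - v) u) + c^-1 / 2 * enorm e ^+ 2.
  have := ler_wpM2l (ltW (divr_gt0 c0 (ltr0n R 2))) H.
  rewrite (_ : c / 2 * (_ + _ + _) = c / 2 * enorm (u - v) ^+ 2
    + (dot (u - v) (b i t) - a^-1 * dot (u - v) u) + c^-1 / 2 * enorm e ^+ 2) //.
  by field; rewrite !gt_eqF.
have cB : c^-1 / 2 * enorm e ^+ 2 <= c^-1 / 2 * B ^+ 2.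
  by rewrite ler_wpM2l // divr_ge0 // invr_ge0 ltW.
have au : 0 <= a^-1 / 2 * enorm u ^+ 2.
  by rewrite mulr_ge0 // divr_ge0 // invr_ge0 ltW.
have -> : dot v (b i t) - dot u (b i t) = - (dot u (b i t) - dot v (b i t)) by ring.
have E2 : a^-1 * dot (u - v) u =
    a^-1 / 2 * (enorm (u - v) ^+ 2 + enorm u ^+ 2 - enorm v ^+ 2).
  by rewrite -uv mulrA divfK // pnatr_eq0.
rewrite E2 dotBl in cM; lra.
Qed.

(** * Bregman bounds and the primal step *)

Let s := sigma_min M n_gt0.

Lemma sigma_min_le i : s <= sigma_ M i.
Proof. exact: bigmin_le. Qed.

Lemma sigma_min_gt0 : 0 < s.
Proof.
rewrite /s /sigma_min; apply: (big_ind (fun u => 0 < u)) => [|u v u0 v0|i _].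
- by have [] := psi_strong Hstanding (Ordinal n_gt0).
- by rewrite lt_min u0.
- by have [] := psi_strong Hstanding i.
Qed.

Lemma breg_lower i y z : X_ P i y -> X_ P i z ->
  s / 2 * enorm (y - z) ^+ 2 <= breg M y z.
Proof.
move=> Xy Xz; have [_ H] := psi_strong Hstanding i.
apply: (@le_trans _ _ (sigma_ M i / 2 * enorm (y - z) ^+ 2)).
  by rewrite ler_wpM2r ?sqr_ge0 // ler_pM2r ?sigma_min_le.
by rewrite /breg; have := H y z Xy Xz; lra.
Qed.

Lemma breg_ge0 i y z : X_ P i y -> X_ P i z -> 0 <= breg M y z.
Proof.
move=> Xy Xz; apply: le_trans (breg_lower Xy Xz).
by rewrite mulr_ge0 ?sqr_ge0 // divr_ge0 // ltW // sigma_min_gt0.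
Qed.

Lemma breg_upper i y z : X_ P i y -> X_ P i z -> breg M y z <= K * enorm (y - z).
Proof.
move=> Xy Xz; have [_ H] := Hbreg; apply: le_trans (H i y z z Xy Xz Xz).
by rewrite (_ : breg M z z = 0) ?subr0 ?ler_norm // /breg dotBr !subrr.
Qed.

(** Change of loss from the new iterate to [y], with [f] linearised at the old iterate and [r] kept
    exact, as in the mirror step. *)
Let regularized_gain i t (y : 'cV[R]_(p i)) : R :=
  dot (df_ P i t (x i t)) (y - x i t.+1) + r_ P i t y - r_ P i t (x i t.+1).

(** Combines first-order optimality of the new iterate, the three-point identity [E3], convexity of
    [g] weighted by [qt >= 0], and strong convexity, which supplies the quadratic term on the
    left. *)
Lemma primal_step i t y : (0 < t)%N -> X_ P i y ->
  dot (qt i t.+1) (b i t) + s / 2 * ialpha t.+1 * enorm (x i t.+1 - x i t) ^+ 2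
  <= dot (qt i t.+1) (g_ P i t y) + regularized_gain t y
     + ialpha t.+1 * (breg M y (x i t) - breg M y (x i t.+1)).
Proof.
move=> t0 Xy; have a0 := ialpha_gt0 t; set a := ialpha t.+1 in a0 *.
have Xx := x_mem i t; have Xx' := x_mem i t.+1.
set x0 := x i t in Xx *; set x1 := x i t.+1 in Xx' *; set u := qt i t.+1.
set l := df_ P i t x0 + (dg_ P i t x0)^T *m u.
(* Up to a constant, the Bregman term is [psi_ M i] minus a linear function, which is merged into
   the linear part. *)
have Hmin : argmin_on (X_ P i) (fun z => dot (a^-1 *: l - dpsi_ M i x0) z
    + a^-1 * r_ P i t z + psi_ M i z) x1.
  have [_ Hm] := xt_step Hrun i t.
  split => // z Xz; have := Hm z Xz; rewrite -x_eq_xt /breg !div1r.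
  rewrite -/x0 -/x1 -/u -/l -/(ialpha t.+1) -/a.
  by rewrite !dotBl !dotZl !dotBr !(dotC l); lra.
have cX := @X_convex _ _ _ _ _ _ Hstanding i.
have cr := @r_convex _ _ _ _ _ _ _ Hfun i t t0.
have := argmin_first_order cX cr _
  (psi_diff Hstanding Xx') Hmin Xy.
rewrite invr_ge0 (ltW a0) => /(_ isT) O.
have {}O : 0 <= dot l (y - x1) + a * dot (dpsi_ M i x1 - dpsi_ M i x0) (y - x1)
    + (r_ P i t y - r_ P i t x1).
  have := mulr_ge0 (ltW a0) O; congr (0 <= _).
  by rewrite dotDl !dotBl dotZl; field; rewrite gt_eqF.
have E3 : dot (dpsi_ M i x1 - dpsi_ M i x0) (y - x1) =
    breg M y x0 - breg M y x1 - breg M x1 x0.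
  by rewrite /breg !dotBl !dotBr; ring.
rewrite E3 /l dotDl -dot_mulmx in O.
have Lg : dot u (dg_ P i t x0 *m (y - x0)) + dot u (g_ P i t x0)
    <= dot u (g_ P i t y).
  rewrite -dotDr; apply: ler_sum => k _; rewrite ler_wpM2l ?qt_ge0 // mxE.
  exact: linearization_le.
have Eg : dg_ P i t x0 *m (y - x1) =
    dg_ P i t x0 *m (y - x0) - dg_ P i t x0 *m (x1 - x0).
  by rewrite -mulmxBr opprB addrA subrK.
rewrite Eg [dot u (_ - _)]dotBr in O.
have Dl := ler_wpM2l (ltW a0) (breg_lower Xx' Xx).
rewrite /regularized_gain /b -/x0 -/x1 [dot u (_ + g_ P i t x0)]dotDr; lra.
Qed.

(** * Step-size sums, consensus error and the combined bound *)

Let kappa_gt0 : 0 < kappa. Proof. by case/andP: Hkappa. Qed.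
Let kappa_lt1 : 0 < 1 - kappa. Proof. by rewrite subr_gt0; case/andP: Hkappa. Qed.
Let kappa'_range : 0 < 1 - kappa < 1.
Proof. by case/andP: Hkappa => *; apply/andP; split; lra. Qed.

Lemma sum_inv_ialpha T :
  \sum_(1 <= t < T.+1) (ialpha t.+1)^-1 <= T%:R `^ (1 - kappa) / (1 - kappa).
Proof.
apply: le_trans (sum_inv_powR T Hkappa); apply: ler_sum_nat => t /andP[t0 _].
by rewrite div1r lef_pV2 ?posrE ?powR_gt0 ?ltr0n // powR_nat_le // ltW.
Qed.

Lemma sum_inv_igamma T :
  \sum_(1 <= t < T.+1) (igamma t)^-1 <= T%:R `^ kappa / kappa.
Proof.
have := sum_inv_powR T kappa'_range; rewrite subKr; apply: le_trans.
by apply: ler_sum_nat => t _; rewrite div1r.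
Qed.

Lemma sum_inv_igammaS T :
  \sum_(1 <= t < T.+1) (igamma t.+1)^-1 <= T%:R `^ kappa / kappa.
Proof.
apply: le_trans (sum_inv_igamma T); apply: ler_sum_nat => t /andP[t0 _].
by rewrite lef_pV2 ?posrE ?powR_gt0 ?ltr0n // powR_nat_le // ltW.
Qed.

Let sqrtn : R := Num.sqrt n%:R.
Let sqrtnM : sqrtn * sqrtn = n%:R.
Proof. by rewrite -expr2 sqr_sqrtr. Qed.

Lemma fnorm_rows (Z : 'M[R]_(n, m)) c : 0 <= c ->
  (forall i, enorm (\col_k Z i k) <= c) -> fnorm Z <= sqrtn * c.
Proof.
move=> c0 Zc; rewrite -(@ler_pXn2r _ 2) ?nnegrE ?fnorm_ge0 ?mulr_ge0 ?sqrtr_ge0 //.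
rewrite sqr_fnorm exprMn [sqrtn ^+ 2]expr2 sqrtnM mulr_natl.
rewrite -[X in _ *+ X](card_ord n) -sumr_const; apply: ler_sum => i _.
apply: (@le_trans _ _ (enorm (\col_k Z i k) ^+ 2)).
  rewrite sqr_enorm le_eqVlt; apply/orP; left; apply/eqP.
  by apply: eq_bigr => k _; rewrite mxE expr2.
by rewrite ler_pXn2r ?nnegrE ?enorm_ge0.
Qed.

Lemma coupling_sum (y : Defs.point R p) T : static_point P T y ->
  \sum_(1 <= t < T.+1) \sum_i dot (qt i t.+1) (g_ P i t (y i))
  <= n%:R * F * B * (4 * n%:R ^+ 3 * iota%:R / w) * (T%:R `^ kappa / kappa).
Proof.
move=> [Xy feas].
pose Q t : 'M[R]_(n, m) := \matrix_(i, k) qt i t k 0.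
pose N t : 'M[R]_(n, m) := \matrix_(i, k) (q i t - qt i t) k 0.
pose Gm t : 'M[R]_(n, m) := \matrix_(i, k) g_ P i t (y i) k 0.
have qt1 i : qt i 1 = 0.
  apply/matrixP => k l; rewrite (ord1 l) (qt_coord i 0 k) mxE big1 // => j _.
  by rewrite /q (q_init Hrun) mxE mulr0.
have Q1 : Q 1%N = 0 by apply/matrixP => i k; rewrite !mxE qt1 mxE.
have QS t : (0 < t)%N -> Q t.+1 = W t *m (Q t + N t).
  move=> _; apply/matrixP => i k; rewrite !mxE qt_coord.
  by apply: eq_bigr => j _; rewrite !mxE addrC subrK.
have Nb t : (0 < t)%N -> fnorm (N t) <= sqrtn * (B * (igamma t)^-1).
  move=> t0; apply: fnorm_rows => [|i].
    by rewrite mulr_ge0 // invr_ge0 powR_ge0.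
  rewrite (_ : \col_k _ = q i t - qt i t); last first.
    by apply/matrixP => k l; rewrite !mxE (ord1 l).
  (* [q_noise] covers rounds from 2 on; in round 1 both dual vectors are zero. *)
  case: t t0 => // -[_|t _]; last by rewrite mulrC; exact: q_noise.
  by rewrite q1_eq0 qt1 subr0 enorm0 mulr_ge0 // invr_ge0 powR_ge0.
have Gb t : (0 < t)%N -> fnorm (Gm t) <= sqrtn * F.
  move=> t0; apply: fnorm_rows => [|i]; first exact: ltW.
  rewrite (_ : \col_k _ = g_ P i t (y i)); last first.
    by apply/matrixP => k l; rewrite !mxE (ord1 l).
  by have [] := F_bound Hfun t0 (Xy i).
have snF : 0 <= sqrtn * F by rewrite mulr_ge0 ?sqrtr_ge0 ?ltW.
have := disagreement_sum Hgraph T n_gt0 snF Q1 QS Nb Gb.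
have -> : \sum_(1 <= t < T.+1) sqrtn * (B * (igamma t)^-1) =
    sqrtn * B * \sum_(1 <= t < T.+1) (igamma t)^-1.
  by rewrite mulr_sumr; apply: eq_bigr => t _; rewrite mulrA.
move=> H; apply: (le_trans (le_trans _ H)).
  apply: ler_sum_nat => t /andP[t0 tT].
  have mean_ge0 k : 0 <= (\sum_j Q t.+1 j k) / n%:R.
    by rewrite divr_ge0 // sumr_ge0 // => j _; rewrite mxE qt_ge0.
  rewrite -subr_le0 /frob -sumrB.
  (* What centring removes is the pairing of the agents' mean, which is nonnegative, with
     [gtot P t y], which is nonpositive because [y] is feasible. *)
  apply: (@le_trans _ _ (\sum_k (\sum_j Q t.+1 j k) / n%:R * gtot P t y k 0)).
    rewrite le_eqVlt; apply/orP; left; apply/eqP.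
    under eq_bigr => i _ do rewrite /dot -sumrB.
    rewrite exchange_big /=; apply: eq_bigr => k _.
    rewrite /gtot summxE mulr_sumr; apply: eq_bigr => i _.
    by rewrite centeredE [Gm _ _ _]mxE [Q _ i _]mxE; ring.
  apply: sumr_le0 => k _; rewrite mulr_ge0_le0 //.
  by have := feas t; rewrite t0 -ltnS tT => /(_ isT k); rewrite mxE.
have [w0 w1] := andP (w_range Hgraph).
apply: (@le_trans _ _ (n%:R * F * B * (4 * n%:R ^+ 3 * iota%:R / w) *
  \sum_(1 <= t < T.+1) (igamma t)^-1)).
  by rewrite -sqrtnM le_eqVlt; apply/orP; left; apply/eqP; ring.
rewrite ler_wpM2l ?sum_inv_igamma //.
by rewrite !mulr_ge0 ?invr_ge0 ?exprn_ge0 // ltW.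
Qed.

Lemma master_bound (y : Defs.point R p) T (v : 'cV[R]_m) :
  static_point P T y -> (forall k, 0 <= v k 0) ->
  \sum_(1 <= t < T.+1) \sum_i (dot v (b i t) - regularized_gain t (y i)
    + s / 2 * ialpha t.+1 * enorm (x i t.+1 - x i t) ^+ 2)
  <= (n%:R * F * B * (4 * n%:R ^+ 3 * iota%:R / w) + n%:R * B ^+ 2 / 2)
       * (T%:R `^ kappa / kappa)
     + n%:R * K * d * T.+1%:R `^ kappa
     + n%:R / 2 * (1 + T%:R `^ (1 - kappa) / (1 - kappa)) * enorm v ^+ 2.
Proof.
move=> yT v0; have [Xy _] := yT.
pose S t := \sum_i enorm (q i t - v) ^+ 2.
pose D t := \sum_i breg M (y i) (x i t).
pose N t := \sum_i dot (qt i t.+1) (g_ P i t (y i)).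
have Srange t : 0 <= S t by apply: sumr_ge0 => i _; exact: sqr_ge0.
have step t : (0 < t)%N -> \sum_i (dot v (b i t) - regularized_gain t (y i)
    + s / 2 * ialpha t.+1 * enorm (x i t.+1 - x i t) ^+ 2)
  <= N t + ialpha t.+1 * (D t - D t.+1)
     + (igamma t / 2 * S t - igamma t.+1 / 2 * S t.+1)
     + n%:R / 2 * enorm v ^+ 2 * (ialpha t.+1)^-1
     + n%:R * B ^+ 2 / 2 * (igamma t.+1)^-1.
  move=> t0; have a0 := ialpha_gt0 t; have c0 := igamma_gt0 t.
  have ac := ialpha_igamma t.
  have cst : igamma t.+1 - (ialpha t.+1)^-1 <= igamma t.
    by have := powR_step Hkappa t0; rewrite div1r.
  have cst0 : 0 <= igamma t.+1 - (ialpha t.+1)^-1.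
    by rewrite subr_ge0 -div1r ler_pdivrMr // mulrC ac ler1n.
  (* Mixing does not increase the distance to [v], and [powR_step] lowers the weight to that of the
     previous round, so these terms telescope. *)
  have Sq : (igamma t.+1 - (ialpha t.+1)^-1) / 2 *
      \sum_i enorm (qt i t.+1 - v) ^+ 2 <= igamma t / 2 * S t.
    apply: ler_pM; rewrite ?divr_ge0 ?ler_pM2r ?sum_qt_le //.
    by apply: sumr_ge0 => i _; exact: sqr_ge0.
  (* [k] is opaque, which keeps [big_split] from splitting it. *)
  have [k kE] : exists k : R, k = (ialpha t.+1)^-1 / 2 * enorm v ^+ 2
      + (igamma t.+1)^-1 * B ^+ 2 / 2 by eexists.
  apply: (@le_trans _ _ (\sum_i (dot (qt i t.+1) (g_ P i t (y i))
    + ialpha t.+1 * (breg M (y i) (x i t) - breg M (y i) (x i t.+1))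
    + ((igamma t.+1 - (ialpha t.+1)^-1) / 2 * enorm (qt i t.+1 - v) ^+ 2
    - igamma t.+1 / 2 * enorm (q i t.+1 - v) ^+ 2)
    + k))).
    apply: ler_sum => i _.
    by have := dual_step i t0 v0; have := primal_step t0 (Xy i); rewrite kE; lra.
  rewrite !big_split /= sumrN -!mulr_sumr sumrB -/(N t) -/(D t) -/(D t.+1).
  by rewrite -/(S t.+1) sumr_const card_ord -[k *+ n]mulr_natl kE; lra.
apply: (@le_trans _ _ (\sum_(1 <= t < T.+1) (N t + ialpha t.+1 * (D t - D t.+1)
     + (igamma t / 2 * S t - igamma t.+1 / 2 * S t.+1)
     + n%:R / 2 * enorm v ^+ 2 * (ialpha t.+1)^-1
     + n%:R * B ^+ 2 / 2 * (igamma t.+1)^-1))).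
  by apply: ler_sum_nat => t /andP[t0 _]; exact: step.
rewrite !big_split /= -!mulr_sumr.
have cN : \sum_(1 <= t < T.+1) N t <= _ := coupling_sum yT.
have K0 : 0 < K by case: Hbreg.
have cD : \sum_(1 <= t < T.+1) ialpha t.+1 * (D t - D t.+1)
    <= n%:R * K * d * T.+1%:R `^ kappa.
  rewrite mulrC; apply: weighted_telescope => t; first exact: powR_ge0.
    by apply: powR_nat_le => //; exact: ltW.
  apply/andP; split; first by apply: sumr_ge0 => i _; exact: breg_ge0 (x_mem _ _).
  rewrite -mulrA mulr_natl -[X in _ *+ X](card_ord n) -sumr_const.
  apply: ler_sum => i _; apply: (le_trans (breg_upper (Xy i) (x_mem i t))).
  by rewrite ler_pM2l //; exact: (@diameter i y (iterates Y t) Xy (iterates_mem t)).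
have cS : \sum_(1 <= t < T.+1) (igamma t / 2 * S t - igamma t.+1 / 2 * S t.+1)
    <= n%:R / 2 * enorm v ^+ 2.
  under eq_bigr => t _ do rewrite -opprB.
  rewrite sumrN telescope_sumr // opprB.
  apply: (@le_trans _ _ (igamma 1 / 2 * S 1%N)).
    by rewrite gerBl mulr_ge0 // divr_ge0 // powR_ge0.
  (* The first weight is 1 and all [q i 1] vanish, so [S 1] is [n * |v|^2]: the summand 1 in the
     factor of [enorm v ^+ 2]. *)
  rewrite /igamma powR1 /S le_eqVlt; apply/orP; left; apply/eqP.
  under eq_bigr => i _ do rewrite q1_eq0 sub0r enormN.
  by rewrite sumr_const card_ord -mulr_natl; ring.
have cb : n%:R / 2 * enorm v ^+ 2 * \sum_(1 <= t < T.+1) (ialpha t.+1)^-1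
    <= n%:R / 2 * enorm v ^+ 2 * (T%:R `^ (1 - kappa) / (1 - kappa)).
  by rewrite ler_wpM2l ?sum_inv_ialpha // mulr_ge0 ?sqr_ge0 // divr_ge0.
have cg : n%:R * B ^+ 2 / 2 * \sum_(1 <= t < T.+1) (igamma t.+1)^-1
    <= n%:R * B ^+ 2 / 2 * (T%:R `^ kappa / kappa).
  by rewrite ler_wpM2l ?sum_inv_igammaS // divr_ge0 // mulr_ge0 ?sqr_ge0.
rewrite sumrB in cS; rewrite sumrN; lra.
Qed.

(** * Per-round estimates for the loss and the violation *)

Lemma young (a z c : R) : 0 < a -> c * z <= a / 2 * z ^+ 2 + c ^+ 2 / (2 * a).
Proof.
move=> a0; rewrite -subr_ge0.
rewrite (_ : _ - _ = (a * z - c) ^+ 2 / (2 * a)); last first.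
  by field; rewrite gt_eqF.
by rewrite divr_ge0 ?sqr_ge0 // mulr_ge0 // ltW.
Qed.

(** Moving from the old iterate to the new one costs at most [G] times the movement for each of [f]
    and [r]; Young's inequality trades this [2 * G] for the quadratic term. *)
Lemma loss_step i t (y : 'cV[R]_(p i)) : (0 < t)%N -> X_ P i y ->
  f_ P i t (x i t) + r_ P i t (x i t) - (f_ P i t y + r_ P i t y)
  <= - regularized_gain t y
     + s / 2 * ialpha t.+1 * enorm (x i t.+1 - x i t) ^+ 2
     + 2 * G ^+ 2 / s * (ialpha t.+1)^-1.
Proof.
move=> t0 Xy; have a0 := ialpha_gt0 t; have s0 := sigma_min_gt0.
have Xx := x_mem i t; have Xx' := x_mem i t.+1.
rewrite /regularized_gain; set D := enorm (x i t.+1 - x i t).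
have [dfG drG _] := G_bound Hfun t0 Xx.
have f1 := @df_subgrad _ _ _ _ _ _ _ Hfun i t _ t0 Xx y Xy.
have r1 := @dr_subgrad _ _ _ _ _ _ _ Hfun i t _ t0 Xx (x i t.+1) Xx'.
have D0 : 0 <= D := enorm_ge0 _.
have fD : - (G * D) <= dot (df_ P i t (x i t)) (x i t.+1 - x i t).
  rewrite lerNl -dotNl; apply: (le_trans (dot_le_enorm _ _)).
  by rewrite enormN ler_wpM2r.
have rD : - (G * D) <= dot (dr_ P i t (x i t)) (x i t.+1 - x i t).
  rewrite lerNl -dotNl; apply: (le_trans (dot_le_enorm _ _)).
  by rewrite enormN ler_wpM2r.
have := young D (2 * G) (mulr_gt0 s0 a0).
rewrite (_ : (2 * G) ^+ 2 / (2 * (s * ialpha t.+1)) =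
  2 * G ^+ 2 / s * (ialpha t.+1)^-1); last by field; rewrite !gt_eqF.
move=> A; rewrite !dotBr in f1 fD *; lra.
Qed.

(** The gain of [y] is at most [2 * G * dist]. Young's inequality with weight [s / 2] leaves
    [4 * G ^ 2 / s] plus [s / 4 * dist ^ 2], and the latter is at most [K * d / 2] since
    [s / 2 * dist ^ 2 <= breg <= K * dist]. The movement inside [b] is absorbed by the quadratic
    term. *)
Lemma violation_step i t (y : 'cV[R]_(p i)) (v : 'cV[R]_m) :
  (0 < t)%N -> X_ P i y -> enorm (y - x i t.+1) <= d ->
  dot v (g_ P i t (x i t)) - (4 * G ^+ 2 / s + K * d / 2)
    - G ^+ 2 / (2 * s) * enorm v ^+ 2 * (ialpha t.+1)^-1
  <= dot v (b i t) - regularized_gain t y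
     + s / 2 * ialpha t.+1 * enorm (x i t.+1 - x i t) ^+ 2.
Proof.
move=> t0 Xy yd; have a0 := ialpha_gt0 t; have s0 := sigma_min_gt0.
have Xx := x_mem i t; have Xx' := x_mem i t.+1.
rewrite /regularized_gain /b; set D := enorm (x i t.+1 - x i t).
have [dfG _ _] := G_bound Hfun t0 Xx; have [_ drG _] := G_bound Hfun t0 Xy.
have r1 := @dr_subgrad _ _ _ _ _ _ _ Hfun i t _ t0 Xy (x i t.+1) Xx'.
set dist := enorm (y - x i t.+1) in yd *.
have dist0 : 0 <= dist := enorm_ge0 _.
have fD : dot (df_ P i t (x i t)) (y - x i t.+1) <= G * dist.
  by apply: (le_trans (dot_le_enorm _ _)); rewrite ler_wpM2r.
have rD : - (G * dist) <= dot (dr_ P i t y) (x i t.+1 - y).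
  rewrite lerNl -dotNr opprB; apply: (le_trans (dot_le_enorm _ _)).
  by rewrite ler_wpM2r.
have bl := le_trans (breg_lower Xy Xx') (breg_upper Xy Xx'); rewrite -/dist in bl.
have K0 : 0 < K by case: Hbreg.
have Kd : K * dist <= K * d by rewrite ler_wpM2l // ltW.
have sh : 0 < s / 2 by rewrite divr_gt0.
have := young dist (2 * G) sh.
rewrite (_ : (2 * G) ^+ 2 / (2 * (s / 2)) = 4 * G ^+ 2 / s); last first.
  by field; rewrite gt_eqF.
have := young D (G * enorm v) (mulr_gt0 s0 a0).
rewrite (_ : (G * enorm v) ^+ 2 / (2 * (s * ialpha t.+1)) =
  G ^+ 2 / (2 * s) * enorm v ^+ 2 * (ialpha t.+1)^-1); last first.
  by field; rewrite !gt_eqF.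
have vD : - (G * enorm v * D) <= dot v (dg_ P i t (x i t) *m (x i t.+1 - x i t)).
  rewrite lerNl -dotNl; apply: (le_trans (dot_le_enorm _ _)); rewrite enormN.
  by rewrite -mulrA mulrCA ler_wpM2l ?enorm_ge0 // enorm_dg.
by rewrite [dot v (_ + _)]dotDr; lra.
Qed.

(** * The constants and the regret bound *)

Let k11 := C11 n iota w F G d.

Let master_constant_le :
  n%:R * F * B * (4 * n%:R ^+ 3 * iota%:R / w) + n%:R * B ^+ 2 / 2 <= k11.
Proof.
have := @graph_constant_le R n iota w n_gt0 (iota_gt0 Hgraph) (w_range Hgraph).
have nFB : 0 <= n%:R * F * B by rewrite !mulr_ge0 // ltW.
move=> /(ler_wpM2l nFB) H; rewrite /k11 /C11 lerD2r.
apply: (le_trans H); rewrite le_eqVlt; apply/orP; left; apply/eqP.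
by rewrite -/B; ring.
Qed.

Lemma C11_ge : n%:R * B ^+ 2 / 2 <= k11.
Proof.
apply: le_trans master_constant_le; rewrite lerDr.
have [w0 _] := andP (w_range Hgraph).
by rewrite !mulr_ge0 ?invr_ge0 ?exprn_ge0 // ltW.
Qed.

Let k11_ge0 : 0 <= k11.
Proof. by apply: le_trans C11_ge; rewrite divr_ge0 // mulr_ge0 ?sqr_ge0. Qed.

Let nKd_ge0 : 0 <= n%:R * K * d.
Proof. by have [K0 _] := Hbreg; rewrite !mulr_ge0 // ltW. Qed.

Let k12 := C12 n G s.

Let k12_ge0 : 0 <= k12.
Proof.
rewrite /k12 /C12 divr_ge0 ?(ltW sigma_min_gt0) //.
by rewrite mulr_ge0 ?sqr_ge0 // mulr_ge0.
Qed.

Let powR_le_max T k : (0 < T)%N -> k <= Num.max (1 - kappa) kappa ->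
  T%:R `^ k <= T%:R `^ Num.max (1 - kappa) kappa :> R.
Proof. by move=> T0 km; rewrite ler_powR // ler1n. Qed.

Lemma regret_bound (y : Defs.point R p) T : (0 < T)%N -> static_point P T y ->
  \sum_(1 <= t < T.+1) (ftot P t (iterates Y t) - ftot P t y)
  <= C1 n iota w F G d K s kappa * T%:R `^ Num.max (1 - kappa) kappa.
Proof.
move=> T0 yT; have [Xy _] := yT; have s0 := sigma_min_gt0.
have z0 (k : 'I_m) : 0 <= (0 : 'cV[R]_m) k 0 by rewrite mxE.
have := master_bound yT z0; rewrite enorm0 expr0n mulr0 addr0 => H.
have dz i t : dot 0 (b i t) = 0.
  by rewrite /dot big1 // => j _; rewrite mxE mul0r.
apply: (@le_trans _ _ (\sum_(1 <= t < T.+1)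
   ((\sum_i (dot 0 (b i t) - regularized_gain t (y i)
    + s / 2 * ialpha t.+1 * enorm (x i t.+1 - x i t) ^+ 2))
    + n%:R * (2 * G ^+ 2 / s) * (ialpha t.+1)^-1))).
  apply: ler_sum_nat => t /andP[t0 _]; rewrite /ftot -sumrB.
  have -> : n%:R * (2 * G ^+ 2 / s) * (ialpha t.+1)^-1 =
      \sum_(i < n) 2 * G ^+ 2 / s * (ialpha t.+1)^-1.
    by rewrite sumr_const card_ord -[RHS]mulr_natl -mulrA.
  rewrite -big_split; apply: ler_sum => i _; rewrite dz sub0r.
  exact: loss_step (Xy i).
rewrite big_split /= -mulr_sumr.
have Ia := sum_inv_ialpha T.
have K1 := powR_le_max T0 (_ : kappa <= _).
have K2 := powR_le_max T0 (_ : 1 - kappa <= _).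
rewrite le_max lexx orbT in K1; rewrite le_max lexx in K2.
move: (K1 isT) (K2 isT) => {}K1 {}K2.
set Tm := T%:R `^ Num.max _ _ in K1 K2 *.
have e1 : (n%:R * F * B * (4 * n%:R ^+ 3 * iota%:R / w) + n%:R * B ^+ 2 / 2)
    * (T%:R `^ kappa / kappa) <= k11 * (Tm / kappa).
  apply: (@le_trans _ _ (k11 * (T%:R `^ kappa / kappa))).
    by rewrite ler_wpM2r ?divr_ge0 ?powR_ge0 ?(ltW kappa_gt0).
  by rewrite ler_wpM2l // ler_pM2r // invr_gt0.
(* Passing from [T + 1] to [T] costs the factor 2 in the last summand of [C1]. *)
have e2 : n%:R * K * d * T.+1%:R `^ kappa <= n%:R * K * d * (2 * Tm).
  rewrite ler_wpM2l // (le_trans (powR_double Hkappa T0)) // ler_wpM2l //.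
have e3 : n%:R * (2 * G ^+ 2 / s) * \sum_(1 <= t < T.+1) (ialpha t.+1)^-1
    <= k12 * (Tm / (1 - kappa)).
  apply: (@le_trans _ _ (k12 * \sum_(1 <= t < T.+1) (ialpha t.+1)^-1)).
    rewrite ler_wpM2r ?sumr_ge0 // => [t _|].
      by rewrite invr_ge0 powR_ge0.
    have : 0 <= n%:R * G ^+ 2 / s.
      by rewrite divr_ge0 ?(ltW s0) // mulr_ge0 ?sqr_ge0.
    by rewrite /k12 /C12; lra.
  by rewrite ler_wpM2l // (le_trans Ia) // ler_pM2r // invr_gt0.
rewrite /C1 -/k11 -/k12; lra.
Qed.

(** * Constraint violation *)

Let gtot_le t : (0 < t)%N -> enorm (gtot P t (iterates Y t)) <= n%:R * F.
Proof.
move=> t0; rewrite /gtot mulr_natl -[X in _ *+ X](card_ord n) -sumr_const.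
elim/big_ind2: _ => [|u a v c ua vc|i _]; first by rewrite enorm0.
  by apply: (le_trans (enormD _ _)); exact: lerD.
by have [] := F_bound Hfun t0 (x_mem i t).
Qed.

Let k21 := C21 n G s kappa.
Let k1 := C1 n iota w F G d K s kappa.

Let gs_ge0 : 0 <= 2 * G ^+ 2 / ((1 - kappa) * s).
Proof.
apply: divr_ge0; first by rewrite mulr_ge0 ?sqr_ge0.
by rewrite mulr_ge0 // ltW // sigma_min_gt0.
Qed.

Let k21_gt0 : 0 < k21.
Proof.
rewrite /k21 /C21 mulr_gt0 ?mulr_gt0 ?ltr0n //.
have := gs_ge0; have : 0 <= 1 / (1 - kappa) by rewrite divr_ge0 // ltW.
by lra.
Qed.

Let k1_ge0 : 0 <= k1.
Proof.
rewrite /k1 /C1 -/k11 -/k12 !addr_ge0 //.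
- by rewrite divr_ge0 // ltW.
- by rewrite divr_ge0 // ltW.
- by have := nKd_ge0; lra.
Qed.

Lemma enorm_pospart_le (v : 'cV[R]_m) : enorm (pospart v) <= enorm v.
Proof.
by have := pospart_contract v (v := 0); rewrite !subr0; apply => k; rewrite mxE.
Qed.

Lemma dot_pospart (v : 'cV[R]_m) : dot (pospart v) v = enorm (pospart v) ^+ 2.
Proof.
rewrite -dot_self; apply: eq_bigr => k _; rewrite mxE.
by case: (lerP (v k 0) 0) => h; rewrite ?mul0r ?mulr0 //.
Qed.

Let viol T := pospart (\sum_(1 <= t < T.+1) gtot P t (iterates Y t)).

(** A single round is settled by the crude bound [n * F], because [violation_dual] starts at
    [T = 2]; here [k21 >= 4 * n] and [k1 >= n * F ^ 2]. *)
Lemma violation_first : enorm (viol 1) ^+ 2 <= k21 * k1.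
Proof.
have V1 : enorm (viol 1) <= n%:R * F.
  by rewrite /viol big_nat1; apply: (le_trans (enorm_pospart_le _)); exact: gtot_le.
have nF0 : 0 <= n%:R * F by rewrite mulr_ge0 // ltW.
apply: (@le_trans _ _ ((n%:R * F) ^+ 2)).
  by rewrite ler_pXn2r ?nnegrE ?enorm_ge0.
have n1 : 0 < n%:R :> R by rewrite ltr0n.
have h21 : 4 * n%:R <= k21.
  rewrite /k21 /C21.
  have h1 := gs_ge0.
  have h2 : 0 <= 1 / (1 - kappa) by rewrite divr_ge0 // ltW.
  rewrite (_ : 4 * n%:R = 2 * n%:R * 2); last by ring.
  by rewrite ler_wpM2l ?mulr_ge0 //; lra.
have h1 : n%:R * F ^+ 2 <= k1.
  apply: (@le_trans _ _ k11).
    apply: le_trans C11_ge; rewrite -mulrA ler_wpM2l // ler_pdivlMr //.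
    have BF : 2 * F <= B by rewrite /B /B1 lerDl mulr_ge0 // ltW.
    by have := F0; nra.
  apply: (@le_trans _ _ (k11 / kappa)).
    by rewrite ler_peMr // invf_ge1 // ltW //; case/andP: Hkappa.
  have : 0 <= k12 / (1 - kappa) by rewrite divr_ge0 // ltW.
  by rewrite /k1 /C1 -/k11 -/k12; have := nKd_ge0; lra.
apply: (@le_trans _ _ (4 * n%:R * (n%:R * F ^+ 2))).
  by have := sqr_ge0 (n%:R * F); lra.
by apply: ler_pM => //; rewrite mulr_ge0 // ?sqr_ge0.
Qed.

Lemma violation_dual T (v : 'cV[R]_m) : (1 < T)%N -> (forall k, 0 <= v k 0) ->
  dot v (\sum_(1 <= t < T.+1) gtot P t (iterates Y t))
  <= k21 * T%:R `^ (1 - kappa) / 4 * enorm v ^+ 2 + k1 * T%:R.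
Proof.
move=> T1 v0; have T0 : (0 < T)%N := ltnW T1; have s0 := sigma_min_gt0.
have [ys [y yT _]] := static_nonempty Hstanding T0; have [Xy _] := yT.
have H := master_bound yT v0.
have K0 : 0 < K by case: Hbreg.
have L : \sum_(1 <= t < T.+1) (dot v (gtot P t (iterates Y t))
    - (n%:R * (4 * G ^+ 2 / s + K * d / 2)
      + n%:R * (G ^+ 2 / (2 * s) * enorm v ^+ 2) * (ialpha t.+1)^-1))
  <= \sum_(1 <= t < T.+1) \sum_i (dot v (b i t) - regularized_gain t (y i)
    + s / 2 * ialpha t.+1 * enorm (x i t.+1 - x i t) ^+ 2).
  apply: ler_sum_nat => t /andP[t0 _].
  set c1 := 4 * G ^+ 2 / s + K * d / 2.
  set c2 := G ^+ 2 / (2 * s) * enorm v ^+ 2.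
  have -> : dot v (gtot P t (iterates Y t)) - (n%:R * c1 + n%:R * c2 / ialpha t.+1)
      = \sum_i (dot v (g_ P i t (x i t)) - c1 - c2 / ialpha t.+1).
    rewrite !sumrB !sumr_const card_ord -dot_sumr -(mulr_natl c1).
    by rewrite -(mulr_natl (c2 / _)) opprD addrA mulrA.
  apply: ler_sum => i _; apply: violation_step => //.
  exact: (@diameter i y (iterates Y t.+1) Xy (iterates_mem _)).
have := le_trans L H; rewrite sumrB big_split /= -!mulr_sumr sumr_const_nat.
rewrite -dot_sumr subSS subn0 -[_ *+ T]mulr_natl.
have Ia := sum_inv_ialpha T.
set Tk := T%:R `^ (1 - kappa) in Ia *.
set N2 := enorm v ^+ 2; have N20 : 0 <= N2 := sqr_ge0 _.
have G20 : 0 <= n%:R * (G ^+ 2 / (2 * s) * N2).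
  by rewrite mulr_ge0 // mulr_ge0 // divr_ge0 ?sqr_ge0 // mulr_ge0 // ltW.
have e0 := ler_wpM2l G20 Ia.
have T2 : 2 <= T%:R :> R by rewrite ler_nat.
have e1 : (n%:R * F * B * (4 * n%:R ^+ 3 * iota%:R / w) + n%:R * B ^+ 2 / 2)
    * (T%:R `^ kappa / kappa) <= k11 / kappa * T%:R.
  rewrite [leRHS]mulrAC -[leRHS]mulrA.
  apply: (@le_trans _ _ (k11 * (T%:R `^ kappa / kappa))).
    by rewrite ler_wpM2r ?divr_ge0 ?powR_ge0 ?(ltW kappa_gt0).
  by rewrite ler_wpM2l // ler_pM2r ?invr_gt0 // powR_nat_le_id.
(* For [T >= 2], [T + 1 <= 3 / 2 * T]; with the [n * K * d / 2] per round from [violation_step] this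
   makes exactly [2 * n * d * K * T]. *)
have e2 : n%:R * K * d * T.+1%:R `^ kappa <= n%:R * K * d * (3 / 2 * T%:R).
  rewrite ler_wpM2l // (le_trans (powR_nat_le_id Hkappa _)) //.
  by rewrite -natr1; lra.
have e3 : k12 * T%:R <= k12 / (1 - kappa) * T%:R.
  rewrite ler_wpM2r // ler_peMr // invf_ge1 //; have := kappa_gt0; lra.
have e4 : n%:R / 2 * N2 <= n%:R * Tk * N2.
  have Tk1 : 1 <= Tk by apply: powR_nat_ge1 => //; exact: ltW.
  rewrite ler_wpM2r // ler_wpM2l //; lra.
have Ek12 : k12 = n%:R * (4 * G ^+ 2 / s).
  by rewrite /k12 /C12; field; rewrite gt_eqF.
have Ek1 : k1 = k11 / kappa + k12 / (1 - kappa) + 2 * n%:R * d * K by [].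
(* The summands of [C21] absorb in turn the movement term of [violation_step] (with a spare copy,
   [e5]), the sum of the [beta] terms, and the initial dual distance ([e4]). *)
have Ek21 : k21 * Tk / 4 * N2 = n%:R * (G ^+ 2 / (2 * s) * N2) * (Tk / (1 - kappa))
   * 2 + n%:R / 2 * (Tk / (1 - kappa)) * N2 + n%:R * Tk * N2.
  rewrite /k21 /C21; field.
  by rewrite !gt_eqF.
have e5 : 0 <= n%:R * (G ^+ 2 / (2 * s) * N2) * (Tk / (1 - kappa)).
  by rewrite mulr_ge0 // divr_ge0 ?powR_ge0 // ltW.
rewrite Ek1 Ek21; rewrite Ek12 in e3 *; lra.
Qed.

Lemma violation_bound T : (0 < T)%N ->
  enorm (viol T)
    <= Num.sqrt (C2 n iota w F G d K s kappa) * T%:R `^ (1 - kappa / 2).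
Proof.
move=> T0.
have C2_ge : k21 * k1 <= C2 n iota w F G d K s kappa.
  rewrite /C2 -/k21 -/k1 ler_wpM2l ?(ltW k21_gt0) // lerDr.
  by rewrite !mulr_ge0 // ltW.
have C2_ge0 : 0 <= C2 n iota w F G d K s kappa.
  by apply: le_trans C2_ge; rewrite mulr_ge0 // ltW.
have Tp : (T%:R `^ (1 - kappa / 2)) ^+ 2 = T%:R `^ (1 - kappa) * T%:R.
  have Tn : (T%:R != 0 :> R) by rewrite pnatr_eq0 -lt0n.
  rewrite expr2 -powRD ?Tn ?implybT // -{3}(@powRr1 _ T%:R) //.
  by rewrite -powRD ?Tn ?implybT //; congr (_ `^ _); field.
rewrite -(@ler_pXn2r _ 2) ?nnegrE ?enorm_ge0 ?mulr_ge0 ?sqrtr_ge0 ?powR_ge0 //.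
rewrite [leRHS]exprMn [in leRHS]sqr_sqrtr // Tp.
apply: (@le_trans _ _ (k21 * k1 * (T%:R `^ (1 - kappa) * T%:R))); last first.
  by rewrite ler_wpM2r // mulr_ge0 ?powR_ge0.
have [T1|] := ltnP 1 T; last first.
  move=> T1; have -> : T = 1%N by apply/eqP; rewrite eqn_leq T1.
  by rewrite powR1 !mulr1 violation_first.
set Tk := T%:R `^ (1 - kappa); have Tk0 : 0 < Tk by rewrite powR_gt0 // ltr0n.
set c := k21 * Tk / 4; have c0 : 0 < c by rewrite divr_gt0 // mulr_gt0.
have ic0 : 0 < (2 * c)^-1 by rewrite invr_gt0 mulr_gt0.
(* This multiple of the violation maximises [<v, z> - c * |v|^2] along its direction, [z] being the
   summed constraints; the maximum is [|viol T|^2 / (4 * c)]. *)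
have v0 k : 0 <= ((2 * c)^-1 *: viol T) k 0.
  by rewrite mxE mulr_ge0 ?pospart_ge0 // ltW.
have := violation_dual T1 v0; rewrite dotZl dot_pospart -/(viol T) -/Tk -/c.
rewrite enormZ exprMn real_normK ?num_real //.
set V2 := enorm _ ^+ 2 => H.
have EV : (2 * c)^-1 * V2 - c * ((2 * c)^-1 ^+ 2 * V2) = V2 / (4 * c).
  by field; rewrite gt_eqF.
have {}H : V2 / (4 * c) <= k1 * T%:R by rewrite -EV; lra.
have c4 : 0 < 4 * c by rewrite mulr_gt0.
move: H; rewrite ler_pdivrMr // => H; apply: (le_trans H).
by rewrite le_eqVlt; apply/orP; left; apply/eqP; rewrite /c; field.
Qed.

End Algorithm.

Theorem corollary1 (R : realType) (n m : nat) (n_gt0 : (0 < n)%N)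
    (p : 'I_n -> nat) (P : problem R m p) (M : mirror R p)
    (E : nat -> rel 'I_n) (W : nat -> 'M[R]_n)
    (Phi : forall i, nat -> 'cV[R]_(p i) -> 'cV[R]_(p i))
    (w F G K d kappa : R) (iota : nat) (Y : trajectory R m p)
    (Hstanding : standing P M)
    (Hgraph : graph_assumption E W w iota)
    (Hfun : function_assumption P F G)
    (Hbreg : bregman_lipschitz P M K)
    (Hcontr : contractive P M Phi)
    (Hd : diameter_bound P d)
    (Hkappa : 0 < kappa < 1)
    (HPhi : forall i t z, (0 < t)%N -> X_ P i z -> Phi i t z = z)
    (Hrun : algorithm_run P M W Phi
              (fun t => 1 / t%:R `^ kappa)
              (fun t => 1 / t%:R `^ kappa)
              (fun t => 1 / t%:R `^ (1 - kappa)) Y)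
    (T : nat) (T_gt0 : (0 < T)%N) :
  let s := sigma_min M n_gt0 in
  (forall xstar, static_optimal P T xstar ->
     regret P T (iterates Y) xstar
       <= C1 n iota w F G d K s kappa * T%:R `^ Num.max (1 - kappa) kappa) /\
  enorm (pospart (\sum_(1 <= t < T.+1) gtot P t (iterates Y t)))
    <= Num.sqrt (C2 n iota w F G d K s kappa) * T%:R `^ (1 - kappa / 2).
Proof.
move=> s; split; last first.
  exact: (violation_bound n_gt0 Hstanding Hgraph Hfun Hbreg Hd Hkappa HPhi Hrun).
move=> xstar [[z zT xz] _]; rewrite /regret /total_loss -sumrB.
rewrite (eq_big_nat _ _ (F2 := fun t => ftot P t (iterates Y t) - ftot P t z)).
  exact: (regret_bound n_gt0 Hstanding Hgraph Hfun Hbreg Hd Hkappa HPhi Hrun).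
by move=> t tT; rewrite xz.
Qed.
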